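(* Let $\lambda>0$, let $\Omega\subseteq\mathbb{R}^d$, let $\phi:\Omega\to\mathbb{R}^n$ be continuous, and assume that $\Omega$ and $x\mapsto\phi(x)$ are definable in an o-minimal structure expanding the real field. Then the set $\mathcal{H}\subseteq\mathbb{R}^n$ has Lebesgue measure zero.
   Context: For $p\in\mathbb{R}^n$, $(\Phi^*p)(x)=\langle\phi(x),p\rangle$, $x\in\Omega$. For a finite signed Radon measure $\mathbf{m}$ on $\Omega$, $|\mathbf{m}|_{TV}=|\mathbf{m}|(\Omega)$ and $\partial|\mathbf{m}|_{TV}=\{f\in C(\Omega):\|f\|_\infty\le1,\ \int f\,d\mathbf{m}=|\mathbf{m}|_{TV}\}$. For $a\in\mathbb{R}^k$, $\mathcal{E}=(x_j)_{j=1}^k\in\Omega^k$: $\mathbf{m}_{a,\mathcal{E}}=\sum_ja_j\delta_{x_j}$ and $\Phi_{\mathcal{E}}\in\mathbb{R}^{n\times k}$ is the matrix with columns $\phi(x_j)$. For a matrix $M$ and index set $S$, $M_S$ is the restriction to the columns indexed by $S$, $M_{(S,\cdot)}$ the restriction to the rows indexed by $S$; $M^\dagger$ is the Moore–Penrose pseudoinverse, $M^*$ the transpose, $M^\dagger_{(S,\cdot)}=(M^\dagger)_{(S,\cdot)}$ and $M_S^\dagger=(M_S)^\dagger$; $S^c$ is the complement in $[k]=\{1,\dots,k\}$; $v_I$ is the restriction of a vector to indices in $I$. The set $\mathcal{H}$ is $$\mathcal{H}=\bigcup_{k=1}^\infty\ \bigcup_{\sigma\in\{-1,+1\}^k}\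 \bigcup_{S\subseteq[k]}\ \bigcup_{I\subseteq S}\mathrm{Bd}\big(\Pi_Y(\mathcal{Q}_{k,S,\sigma,I})\big),$$ where $\mathrm{Bd}$ denotes topological boundary in $\mathbb{R}^n$, $\Pi_Y(y,a,\mathcal{E})=y$, and $\mathcal{Q}_{k,S,\sigma,I}$ is the set of all $(y,a,\mathcal{E})\in\mathbb{R}^n\times\mathbb{R}^k\times\Omega^k$ such that, with $M=\Phi_{\mathcal{E}}$, $$\Phi^*(y-\Phi_{\mathcal{E}}a)\in\lambda\,\partial|\mathbf{m}_{a,\mathcal{E}}|_{TV},\qquad\mathrm{rank}(M)=|S|,$$ $$\Big(\big(M^\dagger_{(S,\cdot)}+M_S^\dagger M_{S^c}M^\dagger_{(S^c,\cdot)}\big)\big(y-(M^* )^\dagger\lambda\sigma\big)\Big)_I=0_I,$$ where the rows of the matrix in the last display are indexed by $S$. *)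

(* Defs.v *)
From HB Require Import structures.
From mathcomp Require Import all_boot all_order all_algebra.
From mathcomp Require Import all_classical all_reals all_analysis.
Set Implicit Arguments.
Unset Strict Implicit.
Unset Printing Implicit Defensive.
Import Order.TTheory GRing.Theory Num.Theory.
Import numFieldNormedType.Exports.
Local Open Scope classical_set_scope.
Local Open Scope ring_scope.

(** Throughout, R^m is ['cV[R]_m]; a function on a subset Omega of R^d is
    represented by a total function of which only the values on Omega matter. *)

(** ** O-minimal structures expanding the real field *)

(** Points of R^(m+1) are split as (R^m, R) by [usubmx], [dsubmx], and as
    (R, R^m) when the dimension is written [1 + m].  [interval R] contains
    bounded and unbounded, open and closed intervals as well as the singletons
    [`[a, a]], so that [om_dim1] says that the members of [Def 1] are exactly
    the finite unions of points and intervals. *)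
Record ominimal_structure (R : realType)
    (Def : forall m, set (set 'cV[R]_m)) : Prop := OminimalStructure {
  om_set0 : forall m, Def m set0;
  om_setC : forall m (A : set 'cV[R]_m), Def m A -> Def m (~` A);
  om_setU : forall m (A B : set 'cV[R]_m),
    Def m A -> Def m B -> Def m (A `|` B);
  om_prodr : forall m (A : set 'cV[R]_m), Def m A ->
    Def (m + 1)%N [set z : 'cV[R]_(m + 1) | A (usubmx z)];
  om_prodl : forall m (A : set 'cV[R]_m), Def m A ->
    Def (1 + m)%N [set z : 'cV[R]_(1 + m) | A (dsubmx z)];
  om_diag : forall m (i j : 'I_m),
    Def m [set z : 'cV[R]_m | z i 0 = z j 0];
  om_proj : forall m (A : set 'cV[R]_(m + 1)), Def (m + 1)%N A ->
    Def m [set usubmx z | z in A];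
  om_lt : Def 2%N [set z : 'cV[R]_2 | z 0 0 < z 1 0];
  om_add : Def 3%N
    [set z : 'cV[R]_3 | z (inord 0) 0 + z (inord 1) 0 = z (inord 2) 0];
  om_mul : Def 3%N
    [set z : 'cV[R]_3 | z (inord 0) 0 * z (inord 1) 0 = z (inord 2) 0];
  om_dim1 : forall A : set 'cV[R]_1, Def 1%N A <->
    exists s : seq (interval R),
      A = [set z : 'cV[R]_1 | exists2 I, I \in s & z 0 0 \in I]
}.

Definition fun_graph (R : realType) (d n : nat) (Omega : set 'cV[R]_d)
    (phi : 'cV[R]_d -> 'cV[R]_n) : set 'cV[R]_(d + n) :=
  [set col_mx x (phi x) | x in Omega].

(** ** Boundary and Lebesgue measure zero in R^n *)

Definition boundary (T : topologicalType) (A : set T) : set T :=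
  closure A `\` interior A.

Definition box (R : realType) (n : nat) (u v : 'cV[R]_n) : set 'cV[R]_n :=
  [set x | forall i, u i 0 <= x i 0 <= v i 0].

Definition box_volume (R : realType) (n : nat) (u v : 'cV[R]_n) : R :=
  \prod_(i < n) (v i 0 - u i 0).

(** Covers are indexed by an arbitrary set [J] of natural numbers, so finite
    and empty covers are allowed; this matters for n = 0, where every box has
    volume 1. *)
Definition lebesgue_outer_measure (R : realType) (n : nat)
    (A : set 'cV[R]_n) : \bar R :=
  ereal_inf [set t | exists (J : set nat) (u v : nat -> 'cV[R]_n),
    [/\ forall j i, u j i 0 <= v j i 0,
        A `<=` \bigcup_(j in J) box (u j) (v j) &
        t = \esum_(j in J) (box_volume (u j) (v j))%:E]].

Definition lebesgue_null (R : realType) (n : nat) (A : set 'cV[R]_n) : Prop :=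
  lebesgue_outer_measure A = 0%E.

(** ** Signed measures on Omega *)

(** The carrier is R^d and the topology of [subspace Omega] is the subspace
    topology on Omega and is discrete outside of it.  Hence Omega is measurable
    and its measurable subsets are its Borel subsets; everything below is
    evaluated on Omega only. *)
Definition borel_on (R : realType) (d : nat) (Omega : set 'cV[R]_d) :=
  g_sigma_algebraType (@open (subspace Omega)).

Section SignedMeasures.
Context (disp : measure_display) (T : measurableType disp) (R : realType).
Implicit Types (nu : {charge set T -> \bar R}) (D : set T) (f : T -> R).

Lemma hahn_pair_ex nu :
  exists PN : set T * set T, hahn_decomposition nu PN.1 PN.2.
Proof. by have [P [N PN]] := Hahn_decomposition nu; exists (P, N). Qed.

(** The Jordan decomposition does not depend on the Hahn decomposition chosen
    here, by [Hahn_decomposition_uniq]. *)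
Definition hahn_pair nu := sval (cid (hahn_pair_ex nu)).

Definition hahn_pairP nu :
    hahn_decomposition nu (hahn_pair nu).1 (hahn_pair nu).2 :=
  svalP (cid (hahn_pair_ex nu)).

Definition total_variation nu D : \bar R :=
  charge_variation (hahn_pairP nu) D.

Definition charge_integral nu D f : \bar R :=
  (\int[jordan_pos (hahn_pairP nu)]_(x in D) (f x)%:E
   - \int[jordan_neg (hahn_pairP nu)]_(x in D) (f x)%:E)%E.

Definition discrete_measure (k : nat) (a : 'cV[R]_k) (x : 'I_k -> T)
    (A : set T) : \bar R :=
  (\sum_(j < k) (a j 0)%:E * \d_(x j) A)%E.

Section DiscreteCharge.
Variables (k : nat) (a : 'cV[R]_k) (x : 'I_k -> T).

Let discrete0 : discrete_measure a x set0 = 0%E.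
Proof. by rewrite /discrete_measure big1// => j _; rewrite measure0 mule0. Qed.

Let discrete_fin (A : set T) :
  measurable A -> discrete_measure a x A \is a fin_num.
Proof.
by move=> mA; rewrite /discrete_measure sum_fin_num; apply/allP => e /mapP[j _ ->].
Qed.

Let discrete_sigma_additive : semi_sigma_additive (discrete_measure a x).
Proof.
move=> F mF tF mUF; rewrite /discrete_measure.
suff cvg_r r : (fun n => \sum_(j <- r) \sum_(0 <= i < n)
      (a j 0)%:E * \d_(x j) (F i))%E @ \oo -->
    (\sum_(j <- r) (a j 0)%:E * \d_(x j) (\bigcup_i F i))%E.
  by under eq_fun do rewrite exchange_big /=; exact: cvg_r.
elim: r => [|j r IH].
  rewrite big_nil (_ : (fun _ => _) = cst 0%E); first exact: cvg_cst.
  by apply/funext => n; rewrite big_nil.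
rewrite big_cons (_ : (fun _ => _) = (fun n => \sum_(0 <= i < n)
    (a j 0)%:E * \d_(x j) (F i)) \+ (fun n => \sum_(j <- r)
    \sum_(0 <= i < n) (a j 0)%:E * \d_(x j) (F i)))%E; last first.
  by apply/funext => n; rewrite big_cons.
apply: cvgeD => //.
have := @charge_semi_sigma_additive _ _ _
  (cscale (a j 0) (charge_of_finite_measure (\d_(x j)))) F mF tF mUF.
exact.
Qed.

HB.instance Definition _ := isCharge.Build _ _ _
  (discrete_measure a x) discrete0 discrete_fin discrete_sigma_additive.

End DiscreteCharge.
End SignedMeasures.

(** [subdiff_tv nu] is the subdifferential of the total variation norm at [nu],
    a set of continuous functions on Omega. *)
Definition subdiff_tv (R : realType) (d : nat) (Omega : set 'cV[R]_d)
    (nu : {charge set (borel_on Omega) -> \bar R}) : set ('cV[R]_d -> R) :=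
  [set f | [/\ {within Omega, continuous f},
    (ereal_sup [set (`|f x|)%:E | x in Omega] <= 1)%E &
    charge_integral nu Omega f = total_variation nu Omega]].

(** ** Moore-Penrose pseudoinverse *)

Section PseudoInverse.
Variable R : realType.

Definition moore_penrose (m n : nat) (M : 'M[R]_(m, n)) (P : 'M[R]_(n, m)) :=
  [/\ M *m P *m M = M, P *m M *m P = P,
      (M *m P)^T = M *m P & (P *m M)^T = P *m M].

Definition pinv (m n : nat) (M : 'M[R]_(m, n)) : 'M[R]_(n, m) :=
  xget 0 [set P | moore_penrose M P].

Lemma moore_penrose_uniq (m n : nat) (M : 'M[R]_(m, n)) (P Q : 'M[R]_(n, m)) :
  moore_penrose M P -> moore_penrose M Q -> P = Q.
Proof.
move=> [MPM PMP MPs PMs] [MQM QMQ MQs QMs].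
have MPQ : M *m P = M *m Q.
  rewrite -[LHS]MPs -{1}MQM -[M *m Q *m M *m P]mulmxA trmx_mul MPs MQs.
  by rewrite mulmxA MPM.
have PMQ : P *m M = Q *m M.
  rewrite -[LHS]PMs -{1}MQM -[M *m Q *m M]mulmxA mulmxA trmx_mul PMs QMs.
  by rewrite -mulmxA (mulmxA M) MPM.
by rewrite -PMP PMQ -mulmxA MPQ mulmxA QMQ.
Qed.

Lemma gram_unit (m r : nat) (C : 'M[R]_(m, r)) :
  \rank C = r -> C^T *m C \in unitmx.
Proof.
move=> rC; rewrite -row_free_unit; apply: inj_row_free => v.
rewrite mulmxA => vCC.
have vC0 : v *m C^T = 0.
  apply/rowP => i; rewrite [RHS]mxE; apply/eqP; rewrite -sqrf_eq0; apply/eqP.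
  have /eqP : \sum_i ((v *m C^T) 0 i) ^+ 2 = 0.
    have : ((v *m C^T) *m (v *m C^T)^T) 0 0 = 0.
      by rewrite trmx_mul trmxK mulmxA vCC mul0mx mxE.
    rewrite mxE => s0; rewrite -[RHS]s0; apply: eq_bigr => l _.
    by rewrite [X in _ * X]mxE expr2.
  rewrite psumr_eq0 => [/allP/(_ i)|l _]; last exact: sqr_ge0.
  by rewrite mem_index_enum => /(_ isT)/eqP.
have : row_free C^T by rewrite /row_free mxrank_tr rC.
by move/row_free_inj => inj; apply: (inj 1%N); rewrite vC0 mul0mx.
Qed.

Lemma moore_penrose_ex (m n : nat) (M : 'M[R]_(m, n)) :
  exists P, moore_penrose M P.
Proof.
have [r [C [B [MCB uC uB]]]] :
    exists (r : nat) (C : 'M[R]_(m, r)) (B : 'M[R]_(r, n)),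
    [/\ M = C *m B, C^T *m C \in unitmx & B *m B^T \in unitmx].
  exists (\rank M), (col_base M), (row_base M); split; first by rewrite mulmx_base.
    by apply: gram_unit; apply/eqP; exact: col_base_full.
  rewrite -{1}[row_base M]trmxK; apply: gram_unit; rewrite mxrank_tr.
  by apply/eqP; exact: row_base_free.
pose C' := invmx (C^T *m C) *m C^T; pose B' := B^T *m invmx (B *m B^T).
have C'C : C' *m C = 1%:M by rewrite /C' -mulmxA mulVmx.
have BB' : B *m B' = 1%:M by rewrite /B' mulmxA mulmxV.
have MP : M *m (B' *m C') = C *m C'.
  by rewrite MCB -mulmxA (mulmxA B) BB' mul1mx.
have PM : B' *m C' *m M = B' *m B.
  by rewrite MCB -mulmxA (mulmxA C') C'C mul1mx.
exists (B' *m C'); split.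
- by rewrite MP MCB -mulmxA (mulmxA C') C'C mul1mx.
- by rewrite PM -mulmxA (mulmxA B) BB' mul1mx.
- by rewrite MP /C' !trmx_mul trmxK trmx_inv trmx_mul trmxK mulmxA.
- by rewrite PM /B' !trmx_mul trmxK trmx_inv trmx_mul trmxK mulmxA.
Qed.

Lemma pinvP (m n : nat) (M : 'M[R]_(m, n)) : moore_penrose M (pinv M).
Proof. by have [P MP] := moore_penrose_ex M; exact: (xgetI 0 MP). Qed.

End PseudoInverse.

(** ** The set H *)

Definition cols (R : realType) (m k : nat) (S : {set 'I_k})
    (M : 'M[R]_(m, k)) : 'M[R]_(m, #|S|) :=
  colsub (@enum_val _ (mem S)) M.

Definition rows (R : realType) (m k : nat) (S : {set 'I_k})
    (M : 'M[R]_(k, m)) : 'M[R]_(#|S|, m) :=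
  rowsub (@enum_val _ (mem S)) M.

Section SetH.
Variables (R : realType) (n d : nat) (lambda : R).
Variables (Omega : set 'cV[R]_d) (phi : 'cV[R]_d -> 'cV[R]_n).

Definition Phi_adj (p : 'cV[R]_n) : 'cV[R]_d -> R :=
  fun x => \sum_(i < n) phi x i 0 * p i 0.

Definition Phi_mx (k : nat) (x : 'I_k -> 'cV[R]_d) : 'M[R]_(n, k) :=
  \matrix_(i, j) phi (x j) i 0.

Definition setQ (k : nat) (S : {set 'I_k}) (sigma : 'cV[R]_k) (I : {set 'I_k}) :
    set ('cV[R]_n * 'cV[R]_k * ('I_k -> 'cV[R]_d)) :=
  [set q | let: (y, a, x) := q in let M := Phi_mx x in
    [/\ forall j, Omega (x j),
        exists2 f, subdiff_tv
            (discrete_measure a (x : 'I_k -> borel_on Omega)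
               : {charge set (borel_on Omega) -> \bar R}) f &
          forall z, Omega z -> Phi_adj (y - M *m a) z = lambda * f z,
        \rank M = #|S| &
        forall j : 'I_#|S|, enum_val j \in I ->
          ((rows S (pinv M) + pinv (cols S M) *m cols (~: S) M
                              *m rows (~: S) (pinv M))
           *m (y - pinv M^T *m (lambda *: sigma))) j 0 = 0]].

Definition signs (k : nat) : set 'cV[R]_k :=
  [set sigma | forall j, sigma j 0 = -1 \/ sigma j 0 = 1].

Definition setH : set 'cV[R]_n :=
  \bigcup_(k in [set k | (0 < k)%N]) \bigcup_(sigma in @signs k)
  \bigcup_(S in [set: {set 'I_k}]) \bigcup_(I in [set I : {set 'I_k} | I \subset S])
    boundary [set q.1.1 | q in setQ S sigma I].

End SetH.

(* Main.v *)
Require Import Defs.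
From HB Require Import structures.
From mathcomp Require Import all_boot all_order all_algebra.
From mathcomp Require Import all_classical all_reals all_analysis.
From mathcomp Require Import measurable_realfun lra ring.
Import Order.TTheory GRing.Theory Num.Theory.
Import numFieldNormedType.Exports.
Local Open Scope classical_set_scope.
Local Open Scope ring_scope.

Set Implicit Arguments.
Unset Strict Implicit.
Unset Printing Implicit Defensive.

(** The set H is a countable union of boundaries of the projections of the sets
    Q, so it is enough that these projections are definable and that the boundary
    of a definable set is null.

    The first point holds because all the data of Q have first-order
    descriptions: the pseudoinverse by the Moore-Penrose equations, the rank by a
    factorization, and the subdifferential condition by the inequality
    |Phi^* p| <= lambda on Omega together with the equality
    sum_j a_j (Phi^* p)(x_j) = lambda |m|(Omega), where |m|(Omega) is computed
    from the total weights of the distinct points among the x_j.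

    The second point is proved by induction on the dimension, without cell
    decomposition.  Let A be a definable subset of R x R^m.  For a box Q with
    rational vertices the set {t | {t} x Q is contained in A} is a finite union
    of intervals.  Hence if t avoids the countably many end points that arise in
    this way from A and from its complement, an interior point w of the slice
    A_t, respectively of its complement, gives an interior point (t, w) of A,
    respectively of its complement.  So the boundary of A, which is closed, has
    its slice at t contained in the boundary of A_t, a null set by induction, and
    a closed set almost all of whose slices are null is null. *)

(** * Lebesgue outer measure *)

Section OuterMeasure.
Context {R : realType}.
Local Notation mu := (@lebesgue_outer_measure R _).

Lemma box_volume_ge0 n (u v : 'cV[R]_n) :
  (forall i, u i 0 <= v i 0) -> 0 <= box_volume u v.
Proof. by move=> uv; apply: prodr_ge0 => i _; rewrite subr_ge0. Qed.

Lemma outer_ge0 n (A : set 'cV[R]_n) : (0 <= mu A)%E.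
Proof.
apply: le_ereal_inf_tmp => _ [J [u [v [uv _ ->]]]].
by apply: esum_ge0 => j _; rewrite lee_fin box_volume_ge0.
Qed.

(** Covers in the definition are indexed by natural numbers. The injection [pickle] carries any
    countable index type there without changing the sum of the volumes. *)
Lemma outer_cover n (I : countType) (J : set I) (u v : I -> 'cV[R]_n)
    (A : set 'cV[R]_n) :
  (forall j i, u j i 0 <= v j i 0) ->
  A `<=` \bigcup_(j in J) box (u j) (v j) ->
  (mu A <= \esum_(j in J) (box_volume (u j) (v j))%:E)%E.
Proof.
move=> uv AJ; apply: ereal_inf_lbound.
pose ext (w : I -> 'cV[R]_n) k := oapp w 0 (unpickle k).
exists (pickle @` J), (ext u), (ext v); split.
- by move=> k i; rewrite /ext; case: unpickle => [j|]//=; exact: uv.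
- move=> x /AJ[j Jj xj]; exists (pickle j); first by exists j.
  by rewrite /ext pickleK.
- rewrite esum_image; last by move=> x y _ _; exact: (pcan_inj pickleK).
  by apply: eq_esum => j _; rewrite /ext pickleK.
Qed.

Lemma outer_box n (u v : 'cV[R]_n) : (forall i, u i 0 <= v i 0) ->
  (mu (box u v) <= (box_volume u v)%:E)%E.
Proof.
move=> uv; rewrite -(@esum_set1 R unit tt (fun=> (box_volume u v)%:E)); last first.
  by rewrite lee_fin box_volume_ge0.
by apply: (outer_cover (u := fun=> u) (v := fun=> v)) => // x ?; exists tt.
Qed.

Lemma le_outer n (A B : set 'cV[R]_n) : A `<=` B -> (mu A <= mu B)%E.
Proof.
move=> AB; apply: ereal_inf_le_tmp => _ [J [u [v [uv BJ ->]]]].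
by exists J, u, v; split => //; exact: subset_trans BJ.
Qed.

Lemma outer_bigcup n (J : set nat) (F : nat -> set 'cV[R]_n) :
  (mu (\bigcup_(j in J) F j) <= \esum_(j in J) mu (F j))%E.
Proof.
(* A finite sum makes every [mu (F j)] finite, which is what yields a cover of [F j] of volume
   exceeding [mu (F j)] by at most a prescribed positive amount. *)
have [E|] := eqVneq (\esum_(j in J) mu (F j))%E +oo%E; first by rewrite E leey.
rewrite -ltey => Elt.
have Jlt j : J j -> (mu (F j) < +oo)%E.
  move=> Jj; apply: le_lt_trans Elt; apply: esum_ge; exists [set j].
    by split => // _ ->.
  by rewrite fsbig_set1.
apply/lee_addgt0Pr => e e0.
pose c k (uv : set nat * ((nat -> 'cV[R]_n) * (nat -> 'cV[R]_n))) :=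
  [/\ forall j i, uv.2.1 j i 0 <= uv.2.2 j i 0,
    F k `<=` \bigcup_(j in uv.1) box (uv.2.1 j) (uv.2.2 j) &
    (\esum_(j in uv.1) (box_volume (uv.2.1 j) (uv.2.2 j))%:E
      <= mu (F k) + (e / (2 ^ k.+1)%:R)%:E)%E].
have /choice[w wP] : forall k, exists uv, J k -> c k uv.
  move=> k; have [Jk|nJk] := pselect (J k); last by exists (set0, (0, 0)).
  have /ereal_inf_lt[_ [K [u [v [uv FK ->]]]] lt_t] :
      (mu (F k) < mu (F k) + (e / (2 ^ k.+1)%:R)%:E)%E.
    rewrite lteDl ?lte_fin ?divr_gt0 ?ltr0n ?expn_gt0 ?e0//.
    by rewrite ge0_fin_numE ?Jlt// outer_ge0.
  by exists (K, (u, v)) => _; split => //; exact: ltW.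
pose P := [set k : nat * nat | J k.1 /\ (w k.1).1 k.2].
(* [outer_cover] asks for ordered corners at every index, whereas [w] is controlled on [J] only;
   hence the default 0 off [P]. *)
pose u (k : nat * nat) := if `[< P k >] then (w k.1).2.1 k.2 else 0.
pose v (k : nat * nat) := if `[< P k >] then (w k.1).2.2 k.2 else 0.
apply: (@le_trans _ _ (\esum_(k in P) (box_volume (u k) (v k))%:E)%E).
  apply: outer_cover.
    move=> k i; rewrite /u /v; case: asboolP => // -[Jk _].
    by have [] := wP _ Jk.
  move=> x [j Jj Fx]; have [_ /(_ _ Fx)[i wi xi] _] := wP _ Jj.
  by exists (j, i) => //=; rewrite /u /v asboolT.
rewrite -(esum_esum (I := J) (J := fun j => (w j).1)
  (a := fun j i => (box_volume (u (j, i)) (v (j, i)))%:E)); last first.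
  move=> i j Ji wj; rewrite lee_fin; apply: box_volume_ge0 => l.
  by rewrite /u /v asboolT//=; have [] := wP _ Ji.
apply: (@le_trans _ _
    (\esum_(j in J) (mu (F j) + (e / (2 ^ j.+1)%:R)%:E))%E).
  apply: le_esum => j Jj; have [_ _] := wP _ Jj; apply: le_trans.
  apply: le_esum => i wi /=.
  by rewrite /u /v asboolT//.
have := @epsilon_trick R (fun j => mu (F j)) e (fun j => j \in J)
  (fun j => outer_ge0 (F j)) (ltW e0).
rewrite !nneseries_esum//; last 2 first.
- by move=> j _; exact: outer_ge0.
- move=> j _; rewrite adde_ge0 ?outer_ge0// lee_fin divr_ge0//; exact: ltW.
by have -> : [set x | x \in J] = J by apply/seteqP; split => x /=; rewrite inE.
Qed.

Lemma outer_setU n (A B : set 'cV[R]_n) :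
  (mu (A `|` B) <= mu A + mu B)%E.
Proof.
apply: le_trans (_ : _ <= \esum_(j in [set 0%N; 1%N])
   mu ((fun k => if k is 0%N then A else B) j))%E _.
  apply: le_trans (outer_bigcup _ _); apply: le_outer.
  by move=> x [Ax|Bx]; [exists 0%N => //; left|exists 1%N => //; right].
rewrite esum_fset//; last by move=> *; exact: outer_ge0.
rewrite fsbigU//= ?fsbig_set1//.
by move=> i [->].
Qed.

Lemma lebesgue_nullW n (A B : set 'cV[R]_n) :
  A `<=` B -> lebesgue_null B -> lebesgue_null A.
Proof.
move=> AB B0; apply/eqP; rewrite eq_le outer_ge0 andbT.
by rewrite -[leRHS]B0 le_outer.
Qed.

Lemma lebesgue_null_set0 n : lebesgue_null (set0 : set 'cV[R]_n).
Proof.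
apply/eqP; rewrite eq_le outer_ge0 andbT.
rewrite -[leRHS](esum_set0 (fun j : nat => (box_volume (0 : 'cV[R]_n) 0)%:E)).
exact: (outer_cover (u := fun=> 0) (v := fun=> 0)).
Qed.

Lemma lebesgue_null_bigcup n (J : set nat) (F : nat -> set 'cV[R]_n) :
  (forall j, J j -> lebesgue_null (F j)) -> lebesgue_null (\bigcup_(j in J) F j).
Proof.
move=> F0; apply/eqP; rewrite eq_le outer_ge0 andbT.
by apply: le_trans (outer_bigcup _ _) _; rewrite esum1.
Qed.

Lemma lebesgue_null_bigcup_count n (I : countType) (J : set I)
    (F : I -> set 'cV[R]_n) :
  (forall j, J j -> lebesgue_null (F j)) -> lebesgue_null (\bigcup_(j in J) F j).
Proof.
move=> F0; apply: (@lebesgue_nullW _ _ (\bigcup_(k in setT)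
    (if unpickle k is Some j then if `[< J j >] then F j else set0 else set0))).
  by move=> x [j Jj Fx]; exists (pickle j) => //; rewrite pickleK asboolT.
apply: lebesgue_null_bigcup => k _.
case: unpickle => [j|]; last exact: lebesgue_null_set0.
by case: asboolP => [/F0//|_]; exact: lebesgue_null_set0.
Qed.

End OuterMeasure.

(** * Outer regularity for null sets, and products with an interval *)

Section OuterRegularity.
Context {R : realType}.
Local Notation mu := (@lebesgue_outer_measure R _).

Lemma cV_nbhsP n (x : 'cV[R]_n) (A : set 'cV[R]_n) :
  nbhs x A <->
  exists2 r : R, 0 < r & (forall y : 'cV[R]_n, (forall i, `|x i 0 - y i 0| < r) -> A y).
Proof.
split.
  move=> /nbhs_ballP[r r0 rA]; exists r => // y xy; apply: rA; split => // i j.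
  by rewrite ord1; exact: xy.
move=> [r r0 rA]; exists (fun i j => ball (x i j) r).
  by move=> i j; exact: nbhsx_ballx.
by move=> y xy; apply: rA => i; exact: xy.
Qed.

Lemma open_box_open n (u v : 'cV[R]_n) :
  open [set x : 'cV[R]_n | forall i, u i 0 < x i 0 < v i 0].
Proof.
rewrite openE => x xuv; exists (fun i _ => [set t | u i 0 < t < v i 0]).
  move=> i j; rewrite ord1; have /andP[ux xv] := xuv i.
  have : open ([set t | u i 0 < t] `&` [set t : R | t < v i 0]).
    by apply: openI; [exact: open_gt|exact: open_lt].
  rewrite openE => /(_ (x i 0)) /=; rewrite ux xv => /(_ (conj isT isT)).
  by apply: filterS => t [/= ut tv]; rewrite ut tv.
by move=> y /= xy i; exact: xy.
Qed.

Lemma outer_box_open n (u v : 'cV[R]_n) (e : R) :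
  (forall i, u i 0 <= v i 0) -> 0 < e ->
  exists U : set 'cV[R]_n, [/\ open U, box u v `<=` U &
    (mu U <= (box_volume u v + e)%:E)%E].
Proof.
move=> uv e0.
(* The volume of the box enlarged by r on every side is a polynomial in r. *)
pose p : {poly R} := \prod_(i < n) ((v i 0 - u i 0)%:P + 2%:P * 'X).
have pE r : p.[r] = box_volume (u - const_mx r) (v + const_mx r).
  rewrite /p horner_prod; apply: eq_bigr => i _.
  by rewrite !hornerE !mxE; ring.
have /cvgrPdist_lt/(_ _ e0) : p.[r] @[r --> (0 : R)] --> p.[0].
  exact: continuous_horner.
move=> /nbhs_ballP[r /= r0 /(_ (r / 2))]; rewrite /ball/= sub0r normrN.
rewrite gtr0_norm ?divr_gt0// => pr.
have {}pr : `|p.[0] - p.[r / 2]| < e by apply: pr; lra.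
pose s : 'cV[R]_n := const_mx (r / 2).
exists [set x | forall i, (u - s) i 0 < x i 0 < (v + s) i 0]; split.
- exact: open_box_open.
- by move=> x xuv i; have /andP[ux xv] := xuv i; rewrite !mxE; lra.
- apply: (@le_trans _ _ (mu (box (u - s) (v + s)))).
    by apply: le_outer => x xuv i; have /andP[/ltW-> /ltW->] := xuv i.
  apply: (le_trans (outer_box _)).
    by move=> i; rewrite !mxE; have := uv i; lra.
  rewrite lee_fin -pE.
  have -> : box_volume u v = p.[0].
    by rewrite pE; congr box_volume; apply/matrixP => i j; rewrite !mxE ?subr0 ?addr0.
  by move: pr; rewrite ltr_norml; lra.
Qed.

(** Half of [e] bounds the volume of a cover by boxes; the other half is shared out geometrically
    among the open enlargements of these boxes. *)
Lemma lebesgue_null_open n (A : set 'cV[R]_n) (e : R) :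
  lebesgue_null A -> 0 < e ->
  exists U : set 'cV[R]_n, [/\ open U, A `<=` U & (mu U <= e%:E)%E].
Proof.
move=> A0 e0; have e20 : 0 < e / 2 by rewrite divr_gt0.
have /ereal_inf_lt[_ [J [u [v [uv AJ ->]]]] lt_t] : (mu A < (e / 2)%:E)%E.
  by rewrite A0 lte_fin.
have /choice[U UP] : forall k, exists U : set 'cV[R]_n,
    [/\ open U, box (u k) (v k) `<=` U &
    (mu U <= (box_volume (u k) (v k) + (e / 2) / (2 ^ k.+1)%:R)%:E)%E].
  by move=> k; apply: outer_box_open => //; rewrite divr_gt0// ltr0n expn_gt0.
exists (\bigcup_(j in J) U j); split.
- by apply: bigcup_open => j _; have [] := UP j.
- by move=> x /AJ[j Jj xj]; exists j => //; have [_ + _] := UP j; exact.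
apply: (le_trans (outer_bigcup _ _)).
apply: (@le_trans _ _ (\esum_(j in J)
    ((box_volume (u j) (v j))%:E + ((e / 2) / (2 ^ j.+1)%:R)%:E))%E).
  by apply: le_esum => j Jj; have [_ _] := UP j; rewrite EFinD.
have vol0 j : (0 <= (box_volume (u j) (v j))%:E)%E.
  by rewrite lee_fin; apply: box_volume_ge0 => i; exact: uv.
have := @epsilon_trick R (fun j => (box_volume (u j) (v j))%:E) (e / 2)
  (fun j => j \in J) vol0 (ltW e20).
rewrite !nneseries_esum//; last first.
  by move=> j _; rewrite adde_ge0// lee_fin divr_ge0//; exact: ltW.
have -> : [set x | x \in J] = J by apply/seteqP; split => x /=; rewrite inE.
move=> /le_trans; apply; rewrite [leRHS](_ : _ = (e / 2 + e / 2)%:E).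
  by rewrite EFinD leeD2r// ltW.
by congr _%:E; lra.
Qed.

(** The strict bound on [mu G] provides a cover of [G] of total volume below [c]; multiplying each
    of its boxes by [[a, b]] covers the slab. *)
Lemma outer_slab n (G : set 'cV[R]_n) (a b c : R) : a <= b ->
  (mu G < c%:E)%E ->
  (mu [set z : 'cV[R]_(1 + n) | (a <= z 0 0 <= b)%R /\ G (dsubmx z)]
    <= ((b - a) * c)%:E)%E.
Proof.
move=> ab /ereal_inf_lt[_ [J [u [v [uv GJ ->]]]] lt_c].
pose w (t : R) (x : 'cV[R]_n) : 'cV[R]_(1 + n) := col_mx (const_mx t) x.
have volE j : box_volume (w a (u j)) (w b (v j)) = (b - a) * box_volume (u j) (v j).
  rewrite /box_volume big_split_ord big_ord1; congr (_ * _).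
    by rewrite !col_mxEu !mxE.
  by apply: eq_bigr => i _; rewrite !col_mxEd.
have sumM : (\esum_(j in J) (box_volume (w a (u j)) (w b (v j)))%:E <=
    (b - a)%:E * \esum_(j in J) (box_volume (u j) (v j))%:E)%E.
  apply: ge_ereal_sup => _ [X [finX XJ] <-].
  rewrite (eq_fsbigr (fun j => (b - a)%:E * (box_volume (u j) (v j))%:E)%E); last first.
    by move=> j _; rewrite volE EFinM.
  rewrite -ge0_mule_fsumr; last first.
    by move=> j; rewrite lee_fin; apply: box_volume_ge0 => i; exact: uv.
  apply: lee_wpmul2l; first by rewrite lee_fin subr_ge0.
  by apply: esum_ge; exists X.
apply: (@le_trans _ _ (\esum_(j in J) (box_volume (w a (u j)) (w b (v j)))%:E)%E).
  apply: outer_cover.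
    move=> j i; rewrite /w -[i]fintype.splitK; case: (fintype.split i) => k /=.
      by rewrite !col_mxEu !mxE.
    by rewrite !col_mxEd; exact: uv.
  move=> z [zab /GJ[j Jj zj]]; exists j => // i.
  rewrite /w -[i]fintype.splitK; case: (fintype.split i) => k /=.
    rewrite !col_mxEu !mxE; rewrite (_ : lshift n k = 0)//.
    by apply: val_inj; rewrite /= ord1.
  by rewrite !col_mxEd; have := zj k; rewrite mxE.
apply: le_trans sumM _.
rewrite EFinM; apply: lee_wpmul2l; first by rewrite lee_fin subr_ge0.
exact: ltW.
Qed.

End OuterRegularity.

(** * Closed sets with null slices *)

Section Slicing.
Context {R : realType}.
Local Notation mu := (@lebesgue_outer_measure R _).

Definition slice n (A : set 'cV[R]_(1 + n)) (t : R) : set 'cV[R]_n :=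
  [set w | A (col_mx (const_mx t) w)].

Lemma slice_dsubmx n (A : set 'cV[R]_(1 + n)) z :
  A z -> slice A (z 0 0) (dsubmx z).
Proof.
rewrite /slice /= -{1}[z]vsubmxK; congr (A (col_mx _ _)).
apply/colP => i; rewrite !mxE; congr (z _ _); apply: val_inj.
by rewrite /= ord1.
Qed.

Lemma continuous_dsubmx n : continuous (@dsubmx R 1 n 1).
Proof.
move=> x A /cV_nbhsP[r r0 rA]; apply/cV_nbhsP; exists r => // y xy.
by apply: rA => i; rewrite !mxE.
Qed.

Lemma continuous_coord n (i : 'I_n) : continuous (fun z : 'cV[R]_n => z i 0).
Proof.
move=> x A /nbhs_ballP[r /= r0 rA]; apply/cV_nbhsP; exists r => // y xy.
exact: rA (xy i).
Qed.

Lemma box_compact n (u v : 'cV[R]_n) : compact (box u v).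
Proof.
have -> : box u v = trmx @` [set x : 'rV[R]_n | forall i,
    [set` `[u i 0, v i 0]%R] (x ord0 i)].
  apply/seteqP; split=> [x xuv|_ [x xuv <-] i].
    by exists x^T; rewrite ?trmxK// => i /=; rewrite in_itv/= mxE; exact: xuv.
  by have := xuv i; rewrite /= in_itv/= mxE.
apply: continuous_compact; last first.
  apply: (@rV_compact R n (fun i => [set` `[u i 0, v i 0]%R])) => i.
  exact: segment_compact.
apply: continuous_subspaceT => x A [P Px PA].
exists (fun i j => P j i); first by move=> i j; have := Px j i; rewrite mxE.
by move=> y Py; apply: PA => i j; rewrite mxE.
Qed.

(** The points of [E] whose tail is outside [G] form a compact set. Its image under the first
    coordinate is closed and misses [s], hence misses a neighbourhood of [s]. *)
Lemma tube_lemma n (E : set 'cV[R]_(1 + n)) u v (G : set 'cV[R]_n) (s : R) :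
  closed E -> E `<=` box u v -> open G -> slice E s `<=` G ->
  exists2 r, 0 < r & forall z, E z -> `|s - z 0 0| < r -> G (dsubmx z).
Proof.
move=> cE Euv oG sG.
pose K := E `&` (@dsubmx R 1 n 1 @^-1` ~` G).
have cK : closed ((fun z : 'cV[R]_(1 + n) => z 0 0) @` K).
  apply: (compact_closed (@Rhausdorff R)).
  apply: continuous_compact.
    by apply: continuous_subspaceT => z; exact: continuous_coord.
  apply: (subclosed_compact _ (@box_compact _ u v)) => [|z [/Euv]//].
  apply: closedI => //; apply: closed_comp => [z _|]; first exact: continuous_dsubmx.
  exact: open_closedC.
have : (~` ((fun z : 'cV[R]_(1 + n) => z 0 0) @` K)) s.
  move=> [z [Ez nGz] zs]; apply: nGz; apply: sG; rewrite -zs.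
  exact: slice_dsubmx.
move: (closed_openC cK); rewrite openE => /[apply] /nbhs_ballP[r /= r0 rK].
exists r => // z Ez sz; apply: contrapT => nGz.
by apply: (rK (z 0 0) sz); exists z.
Qed.

(* Creeping along the first coordinate: the supremum s of the levels below which
   E has outer measure at most e (s - a) can be passed, because near s the set E
   lies in the product of an interval with an open set of measure less than e. *)
Lemma lebesgue_null_slices_bounded n (E : set 'cV[R]_(1 + n)) u v :
  closed E -> E `<=` box u v -> (forall t, lebesgue_null (slice E t)) ->
  lebesgue_null E.
Proof.
move=> cE Euv E0.
(* Subtracting 1 makes the part of [E] at levels up to [a] empty; the maximum keeps [a <= b] even
   when the box is empty. *)
pose a : R := u 0 0 - 1; pose b : R := Num.max a (v 0 0).
have ab : a <= b by rewrite le_max lexx.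
suff Ele (e : R) : 0 < e -> (mu E <= (e * (b - a))%:E)%E.
  apply/eqP; rewrite eq_le outer_ge0 andbT; apply/lee_addgt0Pr => e e0.
  have ba1 : 0 < b - a + 1 by lra.
  apply: (le_trans (Ele (e / (b - a + 1)) _)); first by rewrite divr_gt0.
  rewrite add0e lee_fin mulrAC ler_pdivrMr// ler_pM2l//; lra.
move=> e0.
pose H (s : R) := E `&` [set z | z 0 0 <= s].
pose S : set R := [set s | a <= s <= b /\ (mu (H s) <= (e * (s - a))%:E)%E].
have Sa : S a.
  split; first by rewrite lexx.
  rewrite subrr mulr0 (_ : H a = set0) ?lebesgue_null_set0//.
  apply/seteqP; split => // z [/Euv/(_ 0)/andP[uz _] /=]; rewrite /a; lra.
have supS : has_sup S.
  by split; [exists a|exists b => s [/andP[]]].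
set s := sup S.
have as_ : a <= s by apply: ub_le_sup => //; exact: supS.2.
have sb : s <= b by apply: ge_sup; [exists a|move=> t [/andP[]]].
(* The bound [e / 2] makes the measure of [G] strictly less than [e], as [outer_slab] requires. *)
have [G [oG sG Ge]] := lebesgue_null_open (E0 s) (divr_gt0 e0 (ltr0n R 2)).
have [r r0 rG] := tube_lemma cE Euv oG sG.
have {}r0 : 0 < r / 2 by rewrite divr_gt0.
have [t [/andP[a_t t_b] tS] st] := sup_adherent r0 supS.
have ts : t <= s by apply: ub_le_sup; [exact: supS.2|split => //; rewrite a_t].
(* Levels between [t] and [c] are at distance less than [r] from [s], so there [E] stays in the tube
   over [G]. *)
pose c : R := Num.min b (s + r / 2).
have sc : s <= c by rewrite le_min sb lerDl ltW.
have Sc : S c.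
  split; first by rewrite ge_min lexx andbT (le_trans as_).
  apply: (@le_trans _ _ (mu (H t `|`
      [set z : 'cV[R]_(1 + n) | t <= z 0 0 <= c /\ G (dsubmx z)]))).
    apply: le_outer => z [Ez /= zc].
    have [zt|tz] := leP (z 0 0) t; first by left.
    right; split; first by rewrite zc ltW.
    apply: rG => //; rewrite ltr_norml.
    have : z 0 0 <= s + r / 2 by apply: (le_trans zc); rewrite ge_min lexx orbT.
    move: st; rewrite -/s; lra.
  apply: (le_trans (outer_setU _ _)).
  have Glt : (mu G < e%:E)%E by apply: (le_lt_trans Ge); rewrite lte_fin; lra.
  have tc : t <= c by exact: le_trans sc.
  rewrite (_ : (e * (c - a))%:E = (e * (t - a))%:E + ((c - t) * e)%:E)%E; last first.
    by rewrite -EFinD; congr _%:E; ring.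
  by rewrite leeD// outer_slab.
have cs : c <= s by apply: ub_le_sup => //; exact: supS.2.
(* Since [c <= s < s + r / 2], the minimum defining [c] is [b]. So [b] belongs to [S], and all of
   [E] lies at levels up to [b]. *)
have bc : b = c.
  move: cs; rewrite /c /Num.min; case: ifP => // _; lra.
have [_] := Sc; rewrite -bc; apply: le_trans; apply: le_outer => z Ez; split => //=.
by rewrite /b le_max; have /andP[_ ->] := Euv _ Ez 0; rewrite orbT.
Qed.

Lemma lebesgue_null_slices n (E : set 'cV[R]_(1 + n)) (N : set R) :
  closed E -> countable N -> (forall t, ~ N t -> lebesgue_null (slice E t)) ->
  lebesgue_null E.
Proof.
move=> cE cN E0.
pose B k : set 'cV[R]_(1 + n) := box (const_mx (- k%:R)) (const_mx k%:R).
have BT : E `<=` \bigcup_(k in [set: nat]) (E `&` B k).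
  move=> z Ez; pose m := \sum_i `|z i 0|.
  exists (Num.Def.truncn m).+1 => //; split => // i; rewrite !mxE -ler_norml.
  apply: (@le_trans _ _ m).
    by rewrite /m (bigD1 i)//= lerDl; apply: sumr_ge0.
  by apply/ltW/truncnS_gt.
apply: (lebesgue_nullW BT); apply: lebesgue_null_bigcup => k _.
(* Each [W t] lies in a box whose first side is reduced to a point, hence of volume 0. *)
pose W (t : R) := [set z : 'cV[R]_(1 + n) | z 0 0 = t] `&` B k.
have W0 t : lebesgue_null (W t).
  pose w (c : R) : 'cV[R]_(1 + n) := col_mx (const_mx t) (const_mx c).
  apply: (@lebesgue_nullW _ _ _ (box (w (- k%:R)) (w k%:R))).
    move=> z [/= zt zB] i; rewrite -[i]fintype.splitK; case: (fintype.split i) => j /=.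
      rewrite !col_mxEu !mxE (_ : lshift n j = 0) ?zt ?lexx//.
      by apply: val_inj; rewrite /= ord1.
    by rewrite !col_mxEd !mxE; have := zB (rshift 1 j); rewrite !mxE.
  apply/eqP; rewrite eq_le outer_ge0 andbT.
  apply: (le_trans (outer_box _)).
    move=> i; rewrite -[i]fintype.splitK; case: (fintype.split i) => j /=.
      by rewrite !col_mxEu !mxE.
    by rewrite !col_mxEd !mxE; have := ler0n R k; lra.
  rewrite /box_volume big_split_ord big_ord1 !col_mxEu !mxE subrr /= mul0r.
  exact: lexx.
have WN : lebesgue_null (\bigcup_(t in N) W t).
  (* The index [t] is real, so the union over [N] is rewritten over [nat] by a partial inverse [g]
     of an injection [f] of [N] into [nat]. *)
  have /countable_injP[f f_inj] := cN.
  have [g gK] : exists g : nat -> option R, forall t, N t -> g (f t) = Some t.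
    exists (fun i => if pselect (exists2 t, N t & f t = i) is left p
      then Some (s2val (cid2 p)) else None).
    move=> t Nt; case: pselect => [p|[]]; last by exists t.
    congr Some; case: cid2 => t' /= Nt' ftt'.
    by apply: f_inj => //; rewrite inE.
  apply: (@lebesgue_nullW _ _ _ (\bigcup_(i in [set: nat])
      (if g i is Some t then W t else set0))).
    by move=> z [t Nt Wz]; exists (f t) => //; rewrite gK.
  apply: lebesgue_null_bigcup => i _.
  by case: (g i) => [t|]; [exact: W0|exact: lebesgue_null_set0].
apply/eqP; rewrite eq_le outer_ge0 andbT; apply/lee_addgt0Pr => e e0.
(* Off the slabs over N the set E need not be closed, hence the removal of an
   open neighbourhood of these slabs. *)
have [U [oU WU Ue]] := lebesgue_null_open WN e0.
apply: (@le_trans _ _ (mu (((E `&` B k) `&` ~` U) `|` U))).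
  by apply: le_outer => z Ez; have [Uz|nUz] := pselect (U z); [right|left].
apply: (le_trans (outer_setU _ _)); apply: leeD => //.
suff -> : lebesgue_null ((E `&` B k) `&` ~` U) by [].
apply: (@lebesgue_null_slices_bounded _ _ (const_mx (- k%:R)) (const_mx k%:R)).
- apply: closedI; last exact: open_closedC.
  apply: closedI => //; apply: compact_closed; last exact: box_compact.
  exact: norm_hausdorff.
- by move=> z [[]].
- move=> t; have [Nt|nNt] := pselect (N t).
    apply: (lebesgue_nullW _ (lebesgue_null_set0 n)) => w [[Ew Bw] []].
    apply: WU; exists t => //; split => //=.
    rewrite (_ : 0 = lshift n (0 : 'I_1)); last exact: val_inj.
    by rewrite col_mxEu mxE.
  by apply: lebesgue_nullW (E0 t nNt) => w [[]].
Qed.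

End Slicing.

(** * Definable sets and functions *)

Section Definability.
Context {R : realType} (Def : forall m, set (set 'cV[R]_m)).
Hypothesis omin : ominimal_structure Def.
Arguments Def {m}.

Lemma def_setT m : Def [set: 'cV[R]_m].
Proof. by rewrite -setC0; apply: (om_setC omin); exact: (om_set0 omin). Qed.

Lemma def_setI m (A B : set 'cV[R]_m) : Def A -> Def B -> Def (A `&` B).
Proof.
move=> dA dB; rewrite -[_ `&` _]setCK setCI; apply: (om_setC omin).
by apply: (om_setU omin); exact: (om_setC omin).
Qed.

(** Closure under the connectives is stated for predicates, so that definability proofs follow the
    syntax of first-order formulas. *)
Lemma def_not m (P : 'cV[R]_m -> Prop) :
  Def [set x | P x] -> Def [set x | ~ P x].
Proof. exact: (om_setC omin). Qed.

Lemma def_and m (P Q : 'cV[R]_m -> Prop) :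
  Def [set x | P x] -> Def [set x | Q x] -> Def [set x | P x /\ Q x].
Proof. exact: def_setI. Qed.

Lemma def_or m (P Q : 'cV[R]_m -> Prop) :
  Def [set x | P x] -> Def [set x | Q x] -> Def [set x | P x \/ Q x].
Proof. exact: (om_setU omin). Qed.

Lemma def_imply m (P Q : 'cV[R]_m -> Prop) :
  Def [set x | P x] -> Def [set x | Q x] -> Def [set x | P x -> Q x].
Proof.
move=> dP dQ; rewrite (_ : mkset _ = [set x | ~ P x \/ Q x]).
  by apply: def_or => //; exact: def_not.
apply/seteqP; split => x /=; last by move=> [].
have [Px PQ|nPx _] := pselect (P x).
  by right; exact: PQ.
by left.
Qed.

Lemma def_forall_fin m (I : finType) (P : I -> 'cV[R]_m -> Prop) :
  (forall i, Def [set x | P i x]) -> Def [set x | forall i, P i x].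
Proof.
move=> dP; suff h (s : seq I) : Def [set x | forall i, i \in s -> P i x].
  rewrite (_ : mkset _ = [set x | forall i, i \in enum I -> P i x]); first exact: h.
  by apply/seteqP; split => x /= Px i; [move=> _|]; apply: Px; rewrite ?mem_enum.
elim: s => [|i s IH].
  by rewrite (_ : mkset _ = setT); [exact: def_setT|apply/seteqP; split].
rewrite (_ : mkset _ = [set x | P i x /\ forall j, j \in s -> P j x]).
  exact: def_and.
apply/seteqP; split => x /=.
  by move=> Px; split => [|j js]; apply: Px; rewrite inE ?eqxx// js orbT.
by move=> [Pix Psx] j; rewrite inE => /predU1P[->|/Psx].
Qed.

(* Coordinates are matched by their values in nat, so that the induction on p
   needs no cast between dimensions. *)
Lemma def_truncate p m M (A : set 'cV[R]_M) : M = (m + p)%N -> Def A ->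
  Def [set x : 'cV[R]_m | exists2 z, A z &
    forall (i : 'I_m) (j : 'I_M), i = j :> nat -> x i 0 = z j 0].
Proof.
elim: p m => [|p IH] m.
  rewrite addn0 => e; subst M => dA; rewrite (_ : mkset _ = A)//.
  apply/seteqP; split => [x [z Az xz]|x Ax] /=.
    by rewrite (_ : x = z)//; apply/colP => i; exact: xz.
  by exists x => // i j ij; congr (x _ _); exact: val_inj.
move=> e dA; have e' : M = (m + 1 + p)%N by rewrite e -addnA.
have := om_proj omin (IH (m + 1)%N e' dA); congr Def; apply/seteqP; split.
  move=> _ [y [z Az yz] <-]; exists z => // i j ij.
  by rewrite mxE; apply: yz.
move=> x [z Az xz] /=.
have le_mM : (m + 1 <= M)%N by rewrite e' leq_addr.
exists (\col_i z (widen_ord le_mM i) 0).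
  by exists z => // i j ij; rewrite mxE; congr (z _ _); exact: val_inj.
by apply/colP => i; rewrite !mxE; apply/esym/xz.
Qed.

Lemma def_cylinder m p (B : set 'cV[R]_p) :
  Def B -> Def [set z : 'cV[R]_(m + p) | B (dsubmx z)].
Proof.
elim: m => [|m IH] dB.
  rewrite (_ : mkset _ = B)//; apply/seteqP.
  have e (z : 'cV[R]_(0 + p)) : dsubmx z = z.
    by apply/colP => i; rewrite mxE; congr (z _ _); exact: val_inj.
  by split => z; rewrite /= e.
have := om_prodl omin (IH dB); congr Def.
have e (z : 'cV[R]_(m.+1 + p)) : dsubmx (dsubmx (z : 'cV[R]_(1 + (m + p)))) = dsubmx z.
  by apply/colP => i; rewrite !mxE; congr (z _ _); exact: val_inj.
by apply/seteqP; split => z; rewrite /= e.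
Qed.

(** The map [f] may repeat or omit coordinates. The set is the projection of the pairs [(x, w)] with
    [w] in [B] and each [w i] equal to [x (f i)], which only involves cylinders and diagonals. *)
Lemma def_reindex m p (f : 'I_p -> 'I_m) (B : set 'cV[R]_p) :
  Def B -> Def [set x : 'cV[R]_m | B (\col_i x (f i) 0)].
Proof.
move=> dB.
pose A := [set z : 'cV[R]_(m + p) | B (dsubmx z) /\
  forall i, z (rshift m i) 0 = z (lshift p (f i)) 0].
have dA : Def A.
  apply: def_and; first exact: def_cylinder.
  by apply: def_forall_fin => i; exact: (om_diag omin).
have := def_truncate (erefl _) dA; congr Def; apply/seteqP; split.
  move=> x [z [Bz zf] xz]; rewrite /= (_ : \col_i _ = dsubmx z)//.
  by apply/colP => i; rewrite !mxE zf; exact: xz.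
move=> x Bx; exists (col_mx x (\col_i x (f i) 0)).
  split; first by rewrite col_mxKd.
  by move=> i; rewrite col_mxEd col_mxEu mxE.
move=> i j ij; rewrite (_ : j = lshift p i) ?col_mxEu//.
by apply: val_inj; rewrite /= -ij.
Qed.

Lemma def_exists_cV m p (P : 'cV[R]_m -> 'cV[R]_p -> Prop) :
  Def [set z : 'cV[R]_(m + p) | P (usubmx z) (dsubmx z)] ->
  Def [set x | exists w, P x w].
Proof.
move=> dP; have := def_truncate (erefl _) dP; congr Def; apply/seteqP; split.
  move=> x [z Pz xz]; exists (dsubmx z); rewrite (_ : x = usubmx z)//.
  by apply/colP => i; rewrite !mxE; exact: xz.
move=> x [w Pw]; exists (col_mx x w); first by rewrite /= col_mxKu col_mxKd.
move=> i j ij; rewrite (_ : j = lshift p i) ?col_mxEu//.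
by apply: val_inj; rewrite /= -ij.
Qed.

Lemma def_forall_cV m p (P : 'cV[R]_m -> 'cV[R]_p -> Prop) :
  Def [set z : 'cV[R]_(m + p) | P (usubmx z) (dsubmx z)] ->
  Def [set x | forall w, P x w].
Proof.
move=> dP; rewrite (_ : mkset _ = [set x | ~ exists w, ~ P x w]).
  by apply/def_not/def_exists_cV/def_not.
by apply/seteqP; split => x /=; rewrite -forallNP => Px w; have := Px w; rewrite ?notK.
Qed.

Definition def_fun m (t : 'cV[R]_m -> R) :=
  Def [set z : 'cV[R]_(m + 1) | z (rshift m 0) 0 = t (usubmx z)].

Definition def_mx m p q (F : 'cV[R]_m -> 'M[R]_(p, q)) :=
  forall i j, def_fun (fun z => F z i j).

(** Membership of [g x] in [B] means that some [w] in [B] satisfies [w i = g x i] for all [i], and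
    each of these equations is a reindexed graph. *)
Lemma def_preimage m p (B : set 'cV[R]_p) (g : 'cV[R]_m -> 'cV[R]_p) :
  Def B -> def_mx g -> Def [set x | B (g x)].
Proof.
move=> dB dg.
rewrite (_ : mkset _ = [set x | exists w, B w /\ forall i, w i 0 = g x i 0]).
  apply: def_exists_cV; apply: def_and; first exact: def_cylinder.
  apply: def_forall_fin => i.
  (* The parameters are kept, and the value coordinate of the graph becomes the [i]-th coordinate of
     [w]. *)
  pose f (j : 'I_(m + 1)) : 'I_(m + p) :=
    match fintype.split j with inl j => lshift p j | inr _ => rshift m i end.
  have := def_reindex f (dg i 0); congr Def.
  have fl j : f (lshift 1 j) = lshift p j.
    by rewrite /f (unsplitK (inl _ j)).
  have fr j : f (rshift m j) = rshift m i.
    by rewrite /f (unsplitK (inr _ j)).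
  apply/seteqP; split => z /=; rewrite !mxE fr;
    (have -> : usubmx (\col_i0 z (f i0) 0) = usubmx z by
      apply/colP => j; rewrite !mxE fl); by [].
apply/seteqP; split => x /= => [Bgx|[w [Bw wg]]]; first by exists (g x).
by rewrite (_ : g x = w)//; apply/colP => i; rewrite wg.
Qed.

Lemma def_fun_reindex m p (f : 'I_p -> 'I_m) (t : 'cV[R]_p -> R) :
  def_fun t -> def_fun (fun x => t (\col_i x (f i) 0)).
Proof.
move=> dt; pose f' (j : 'I_(p + 1)) : 'I_(m + 1) :=
  match fintype.split j with inl j => lshift 1 (f j) | inr j => rshift m j end.
have := def_reindex f' dt; congr Def.
have fl j : f' (lshift 1 j) = lshift 1 (f j).
  by rewrite /f' (unsplitK (inl _ j)).
have fr j : f' (rshift p j) = rshift m j.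
  by rewrite /f' (unsplitK (inr _ j)).
by apply/seteqP; split => z /=; rewrite !mxE fr;
  (have -> : usubmx (\col_i z (f' i) 0) = \col_i usubmx z (f i) 0 by
    apply/colP => j; rewrite !mxE fl).
Qed.

Lemma def_fun_coord m (i : 'I_m) : def_fun (fun z => z i 0).
Proof.
have := om_diag omin (rshift m (0 : 'I_1)) (lshift 1 i); congr Def.
by apply/seteqP; split => z; rewrite /= mxE.
Qed.

Lemma def_fun_usubmx m p (t : 'cV[R]_m -> R) :
  def_fun t -> def_fun (fun z : 'cV[R]_(m + p) => t (usubmx z)).
Proof.
move=> dt; have := def_fun_reindex (lshift p) dt; congr def_fun.
by apply/funext => z; congr t; apply/colP => i; rewrite !mxE.
Qed.

Lemma def_fun_graph m (t : 'cV[R]_m -> R) p (B : set 'cV[R]_p)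
    (g : 'cV[R]_(m + 1) -> 'cV[R]_p) :
  Def B -> def_mx g ->
  (forall z, B (g z) <-> z (rshift m 0) 0 = t (usubmx z)) -> def_fun t.
Proof.
move=> dB dg BgE; have := def_preimage dB dg; congr Def.
by apply/seteqP; split => z /=; rewrite BgE.
Qed.

Lemma def_fun_comp m p (t : 'cV[R]_p -> R) (g : 'cV[R]_m -> 'cV[R]_p) :
  def_fun t -> def_mx g -> def_fun (fun x => t (g x)).
Proof.
move=> dt dg.
apply: (def_fun_graph (g := fun z => col_mx (g (usubmx z)) (dsubmx z)) dt).
  move=> i j; rewrite !ord1; rewrite -[i]fintype.splitK.
  case: (fintype.split i) => k /=.
    rewrite (_ : (fun _ => _) = (fun z : 'cV_(m + 1) => g (usubmx z) k 0)).
      exact: (def_fun_usubmx 1 (dg k 0)).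
    by apply/funext => z; rewrite col_mxEu.
  rewrite (_ : (fun _ => _) = (fun z : 'cV_(m + 1) => z (rshift m k) 0)).
    exact: def_fun_coord.
  by apply/funext => z; rewrite col_mxEd mxE.
by move=> z; rewrite /= col_mxKu col_mxEd mxE.
Qed.

(** Arbitrary real parameters are allowed because the singleton of [c] is the interval [[c, c]],
    definable by [om_dim1]. *)
Lemma def_fun_cst m (c : R) : def_fun (fun _ : 'cV[R]_m => c).
Proof.
have d1 : Def [set z : 'cV[R]_1 | z 0 0 = c].
  apply/(om_dim1 omin); exists [:: `[c, c]].
  apply/seteqP; split => z /=.
    by move=> ->; exists `[c, c]; rewrite ?inE// in_itv/= lexx.
  by move=> [I]; rewrite mem_seq1 => /eqP ->; rewrite in_itv/= -eq_le => /eqP ->.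
apply: (def_fun_graph (g := dsubmx) d1).
  move=> i j; rewrite !ord1.
  rewrite (_ : (fun _ => _) = (fun z : 'cV_(m + 1) => z (rshift m 0) 0)).
    exact: def_fun_coord.
  by apply/funext => z; rewrite mxE.
by move=> z; rewrite /= mxE.
Qed.

End Definability.

(** * Definability of arithmetic, matrix operations, pseudoinverse and rank *)

Section DefinableOperations.
Context {R : realType} (Def : forall m, set (set 'cV[R]_m)).
Hypothesis omin : ominimal_structure Def.
Local Notation def_fun := (def_fun Def).
Local Notation def_mx := (def_mx Def).
Arguments Def {m}.

Lemma def_mx_usubmx m p q r (F : 'cV[R]_m -> 'M[R]_(p + q, r)) :
  def_mx F -> def_mx (fun z => usubmx (F z)).
Proof.
move=> dF i j; rewrite (_ : (fun _ => _) = (fun z => F z (lshift q i) j)) //.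
by apply/funext => z; rewrite mxE.
Qed.

Lemma def_mx_dsubmx m p q r (F : 'cV[R]_m -> 'M[R]_(p + q, r)) :
  def_mx F -> def_mx (fun z => dsubmx (F z)).
Proof.
move=> dF i j; rewrite (_ : (fun _ => _) = (fun z => F z (rshift p i) j)) //.
by apply/funext => z; rewrite mxE.
Qed.

Lemma def_mx_id m : def_mx (fun z : 'cV[R]_m => z).
Proof. by move=> i j; rewrite ord1; exact: def_fun_coord. Qed.

Lemma def_mx_comp m l p q (F : 'cV[R]_l -> 'M[R]_(p, q)) (g : 'cV[R]_m -> 'cV[R]_l) :
  def_mx F -> def_mx g -> def_mx (fun z => F (g z)).
Proof. by move=> dF dg i j; exact: def_fun_comp (dF i j) dg. Qed.

Lemma def_fun_mx m (t : 'cV[R]_m -> R) p q :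
  def_fun t -> def_mx (fun z => const_mx (t z) : 'M[R]_(p, q)).
Proof.
move=> dt i j; rewrite (_ : (fun _ => _) = t)//.
by apply/funext => z; rewrite mxE.
Qed.

Lemma def_mx_col m p q r (F : 'cV[R]_m -> 'M[R]_(p, r)) (G : 'cV[R]_m -> 'M[R]_(q, r)) :
  def_mx F -> def_mx G -> def_mx (fun z => col_mx (F z) (G z)).
Proof.
move=> dF dG i j; rewrite -[i]fintype.splitK; case: (fintype.split i) => k /=.
  rewrite (_ : (fun _ => _) = (fun z => F z k j))//.
  by apply/funext => z; rewrite col_mxEu.
rewrite (_ : (fun _ => _) = (fun z => G z k j))//.
by apply/funext => z; rewrite col_mxEd.
Qed.

Lemma def_eq m (s t : 'cV[R]_m -> R) :
  def_fun s -> def_fun t -> Def [set x | s x = t x].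
Proof.
move=> ds dt; pose g x : 'cV[R]_(1 + 1) := col_mx (const_mx (s x)) (const_mx (t x)).
rewrite (_ : mkset _ = [set x | g x (lshift 1 0) 0 = g x (rshift 1 0) 0]).
  apply: (def_preimage omin (om_diag omin _ _)).
  by apply: (@def_mx_col m 1 1 1); exact: def_fun_mx.
by apply/seteqP; split => x /=; rewrite col_mxEu col_mxEd !mxE.
Qed.

Lemma def_lt m (s t : 'cV[R]_m -> R) :
  def_fun s -> def_fun t -> Def [set x | s x < t x].
Proof.
move=> ds dt; pose g x : 'cV[R]_(1 + 1) := col_mx (const_mx (s x)) (const_mx (t x)).
rewrite (_ : mkset _ = [set x | g x 0 0 < g x 1 0]).
  apply: (def_preimage omin (om_lt omin)).
  by apply: (@def_mx_col m 1 1 1); exact: def_fun_mx.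
have e0 : 0 = lshift 1 (0 : 'I_1) by exact: val_inj.
have e1 : 1 = rshift 1 (0 : 'I_1) by exact: val_inj.
by apply/seteqP; split => x /=; rewrite e0 e1 col_mxEu col_mxEd !mxE.
Qed.

Lemma def_le m (s t : 'cV[R]_m -> R) :
  def_fun s -> def_fun t -> Def [set x | s x <= t x].
Proof.
move=> ds dt; rewrite (_ : mkset _ = [set x | ~ (t x < s x)]).
  by apply: def_not => //; exact: def_lt.
by apply/seteqP; split => x /=; rewrite leNgt; move/negP.
Qed.

(** Common to addition and multiplication: the set is the preimage of the graph of [op] under
    [(s, t, u)], once the indices [inord] are matched with block positions. *)
Lemma def_fun_graph3 (op : R -> R -> R) m (s t u : 'cV[R]_m -> R) :
  Def [set z : 'cV[R]_3 | op (z (inord 0) 0) (z (inord 1) 0) = z (inord 2) 0] ->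
  def_fun s -> def_fun t -> def_fun u -> Def [set x | op (s x) (t x) = u x].
Proof.
move=> dop ds dt du.
pose g x : 'cV[R]_(1 + (1 + 1)) :=
  col_mx (const_mx (s x)) (col_mx (const_mx (t x)) (const_mx (u x))).
have e0 : inord 0 = lshift 2 (0 : 'I_1) by apply: val_inj; rewrite /= inordK.
have e1 : inord 1 = rshift 1 (lshift 1 (0 : 'I_1)) by apply: val_inj; rewrite /= inordK.
have e2 : inord 2 = rshift 1 (rshift 1 (0 : 'I_1)) by apply: val_inj; rewrite /= inordK.
rewrite (_ : mkset _ =
    [set x | op (g x (inord 0) 0) (g x (inord 1) 0) = g x (inord 2) 0]).
  apply: (def_preimage omin dop).
  by apply: (@def_mx_col m 1 2 1); [|apply: (@def_mx_col m 1 1 1)]; exact: def_fun_mx.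
by apply/seteqP; split => x /=; rewrite e0 e1 e2 !col_mxEd !col_mxEu !mxE.
Qed.

Lemma def_fun_graphE m (s : 'cV[R]_m -> R) (P : 'cV[R]_(m + 1) -> Prop) :
  Def [set z | P z] -> (forall z, P z <-> z (rshift m 0) 0 = s (usubmx z)) ->
  def_fun s.
Proof. by move=> dP /(def_fun_graph omin dP); apply; exact: def_mx_id. Qed.

Lemma def_fun_last m : def_fun (fun z : 'cV[R]_(m + 1) => z (rshift m 0) 0).
Proof. exact: def_fun_coord. Qed.

Lemma def_add m (s t : 'cV[R]_m -> R) :
  def_fun s -> def_fun t -> def_fun (fun x => s x + t x).
Proof.
move=> /(def_fun_usubmx omin 1) ds /(def_fun_usubmx omin 1) dt.
exact: (def_fun_graphE (def_fun_graph3 (om_add omin) ds dt (def_fun_last m))).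
Qed.

Lemma def_mul m (s t : 'cV[R]_m -> R) :
  def_fun s -> def_fun t -> def_fun (fun x => s x * t x).
Proof.
move=> /(def_fun_usubmx omin 1) ds /(def_fun_usubmx omin 1) dt.
exact: (def_fun_graphE (def_fun_graph3 (om_mul omin) ds dt (def_fun_last m))).
Qed.

Lemma def_opp m (s : 'cV[R]_m -> R) : def_fun s -> def_fun (fun x => - s x).
Proof.
move=> ds; rewrite (_ : (fun _ => _) = (fun x => (-1) * s x)).
  by apply: def_mul => //; exact: def_fun_cst.
by apply/funext => x; rewrite mulN1r.
Qed.

Lemma def_sum m (I : Type) (r : seq I) (P : pred I) (s : I -> 'cV[R]_m -> R) :
  (forall i, def_fun (s i)) -> def_fun (fun x => \sum_(i <- r | P i) s i x).
Proof.
move=> ds; elim: r => [|i r IH].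
  rewrite (_ : (fun _ => _) = (fun=> 0)); first exact: def_fun_cst.
  by apply/funext => x; rewrite big_nil.
rewrite (_ : (fun _ => _) = (fun x => (if P i then s i x else 0) +
  \sum_(i <- r | P i) s i x)).
  by apply: def_add => //; case: (P i) => //; exact: def_fun_cst.
by apply/funext => x; rewrite big_cons; case: ifP => // _; rewrite add0r.
Qed.

Lemma def_if m (P : 'cV[R]_m -> Prop) (s t : 'cV[R]_m -> R) :
  Def [set x | P x] -> def_fun s -> def_fun t ->
  def_fun (fun x => if `[< P x >] then s x else t x).
Proof.
move=> dP ds dt.
apply: (@def_fun_graphE _ _ (fun z =>
   (P (usubmx z) /\ z (rshift m 0) 0 = s (usubmx z)) \/
   (~ P (usubmx z) /\ z (rshift m 0) 0 = t (usubmx z)))).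
  have dPu : Def [set z : 'cV[R]_(m + 1) | P (usubmx z)].
    by apply: (def_preimage omin dP); apply: def_mx_usubmx; exact: def_mx_id.
  apply: (def_or omin); apply: (def_and omin) => //; by apply: def_not.
move=> z; case: asboolP => [p|np]; split; tauto.
Qed.

Lemma def_mulmx m p q r (F : 'cV[R]_m -> 'M[R]_(p, q)) (G : 'cV[R]_m -> 'M[R]_(q, r)) :
  def_mx F -> def_mx G -> def_mx (fun z => F z *m G z).
Proof.
move=> dF dG i j; rewrite (_ : (fun _ => _) = (fun z => \sum_k F z i k * G z k j)).
  by apply: def_sum => k; exact: def_mul.
by apply/funext => z; rewrite mxE.
Qed.

Lemma def_addmx m p q (F G : 'cV[R]_m -> 'M[R]_(p, q)) :
  def_mx F -> def_mx G -> def_mx (fun z => F z + G z).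
Proof.
move=> dF dG i j; rewrite (_ : (fun _ => _) = (fun z => F z i j + G z i j)).
  exact: def_add.
by apply/funext => z; rewrite mxE.
Qed.

Lemma def_oppmx m p q (F : 'cV[R]_m -> 'M[R]_(p, q)) :
  def_mx F -> def_mx (fun z => - F z).
Proof.
move=> dF i j; rewrite (_ : (fun _ => _) = (fun z => - F z i j)).
  exact: def_opp.
by apply/funext => z; rewrite mxE.
Qed.

Lemma def_cstmx m p q (M : 'M[R]_(p, q)) : def_mx (fun _ : 'cV[R]_m => M).
Proof. by move=> i j; exact: def_fun_cst. Qed.

Lemma def_trmx m p q (F : 'cV[R]_m -> 'M[R]_(p, q)) :
  def_mx F -> def_mx (fun z => (F z)^T).
Proof.
move=> dF i j; rewrite (_ : (fun _ => _) = (fun z => F z j i))//.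
by apply/funext => z; rewrite mxE.
Qed.

Lemma def_mxsub m p q p' q' (f : 'I_p' -> 'I_p) (g : 'I_q' -> 'I_q)
    (F : 'cV[R]_m -> 'M[R]_(p, q)) :
  def_mx F -> def_mx (fun z => mxsub f g (F z)).
Proof.
move=> dF i j; rewrite (_ : (fun _ => _) = (fun z => F z (f i) (g j)))//.
by apply/funext => z; rewrite mxE.
Qed.

Lemma def_eqmx m p q (F G : 'cV[R]_m -> 'M[R]_(p, q)) :
  def_mx F -> def_mx G -> Def [set z | F z = G z].
Proof.
move=> dF dG; rewrite (_ : mkset _ = [set z | forall i j, F z i j = G z i j]).
  by apply: def_forall_fin => // i; apply: def_forall_fin => // j; exact: def_eq.
by apply/seteqP; split => z /=; [move=> -> | move/matrixP].
Qed.

(** Definable sets consist of column vectors, so a quantified matrix is encoded by its entries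
    through the bijection [vec_mx]. *)
Lemma def_exists_mx m p q (P : 'cV[R]_m -> 'M[R]_(p, q) -> Prop) :
  Def [set z : 'cV[R]_(m + p * q) | P (usubmx z) (vec_mx (dsubmx z)^T)] ->
  Def [set x | exists M, P x M].
Proof.
move=> dP; rewrite (_ : mkset _ = [set x | exists w, P x (vec_mx w^T)]).
  exact: (def_exists_cV omin).
apply/seteqP; split => x /= [M PM]; last by exists (vec_mx M^T).
by exists (mxvec M)^T; rewrite trmxK mxvecK.
Qed.

Lemma def_vec_mx m p q (F : 'cV[R]_m -> 'rV[R]_(p * q)) :
  def_mx F -> def_mx (fun z => vec_mx (F z)).
Proof.
move=> dF i j; rewrite (_ : (fun _ => _) = (fun z => F z 0 (mxvec_index i j)))//.
by apply/funext => z; rewrite mxE.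
Qed.

(** Existence and uniqueness of the solution of the Moore-Penrose equations turn these polynomial
    equations into a description of the graph. *)
Lemma def_pinv m p q (F : 'cV[R]_m -> 'M[R]_(p, q)) :
  def_mx F -> def_mx (fun z => Defs.pinv (F z)).
Proof.
move=> dF i j.
apply: (@def_fun_graphE _ _ (fun z => exists P, moore_penrose (F (usubmx z)) P /\
   z (rshift m 0) 0 = P i j)).
  apply: def_exists_mx => //.
  set V := fun z : 'cV[R]_(m + 1 + q * p) => vec_mx (dsubmx z)^T.
  have dV : def_mx V.
    by apply/def_vec_mx/def_trmx/def_mx_dsubmx; exact: def_mx_id.
  have dFu : def_mx (fun z : 'cV[R]_(m + 1 + q * p) => F (usubmx (usubmx z))).
    by apply: (def_mx_comp dF); do 2 apply: def_mx_usubmx; exact: def_mx_id.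
  have dPF := def_mulmx dFu dV.
  have dFP := def_mulmx dV dFu.
  rewrite (_ : mkset _ = [set z : 'cV[R]_(m + 1 + q * p) |
    ((F (usubmx (usubmx z)) *m V z *m F (usubmx (usubmx z)) = F (usubmx (usubmx z)) /\
     V z *m F (usubmx (usubmx z)) *m V z = V z) /\
    ((F (usubmx (usubmx z)) *m V z)^T = F (usubmx (usubmx z)) *m V z /\
     (V z *m F (usubmx (usubmx z)))^T = V z *m F (usubmx (usubmx z)))) /\
     z (lshift (q * p) (rshift m 0)) 0 = V z i j]).
    apply: (def_and omin); last by apply: def_eq => //; exact: def_fun_coord.
    by apply: (def_and omin); apply: (def_and omin); apply: def_eqmx => //;
      first [exact: def_mulmx|exact: def_trmx].
  apply/seteqP; split => z /=; rewrite [usubmx z (rshift m 0) 0]mxE.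
    by move=> [[? ? ? ?] ?].
  by move=> [[[? ?] [? ?]] ?].
move=> z; split => [[P [PF ->]]|->].
  by rewrite (moore_penrose_uniq PF (pinvP _)).
by exists (Defs.pinv (F (usubmx z))); split => //; exact: pinvP.
Qed.

(** The factorization through dimension [r] bounds the rank above, and the identity matrix obtained
    from [M] by multiplication bounds it below. Both are polynomial equations in the quantified
    matrices. *)
Lemma mxrankP p q r (M : 'M[R]_(p, q)) : \rank M = r <->
  exists (C : 'M[R]_(p, r)) (B : 'M[R]_(r, q)) (C' : 'M[R]_(r, p)) (B' : 'M[R]_(q, r)),
    M = C *m B /\ C' *m M *m B' = 1%:M.
Proof.
split=> [<-|[C [B [C' [B' [MCB CMB]]]]]].
  have [[C' C'C] [B' BB']] :
      (exists C', C' *m col_base M = 1%:M) /\ (exists B', row_base M *m B' = 1%:M).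
    split; last by apply/row_freeP; exact: row_base_free.
    by apply/row_fullP; exact: col_base_full.
  exists (col_base M), (row_base M), C', B'; rewrite mulmx_base; split => //.
  by rewrite -[X in C' *m X](mulmx_base M) mulmxA C'C mul1mx.
apply/eqP; rewrite eqn_leq {1}MCB mulmx_max_rank /=.
rewrite -{1}(@mxrank1 R r) -CMB; apply: leq_trans (mxrankM_maxl _ _) _.
exact: mxrankM_maxr.
Qed.

End DefinableOperations.

Ltac def_mx_tac := repeat first
  [ exact: def_mx_id | apply: def_mulmx | apply: def_addmx | apply: def_oppmx
  | apply: def_vec_mx | apply: def_trmx | apply: def_mx_usubmx
  | apply: def_mx_dsubmx | apply: def_pinv | apply: def_mxsub
  | match goal with H : _ |- _ => apply: H end | exact: def_cstmx ].

Lemma def_rank (R : realType) (Def : forall m, set (set 'cV[R]_m)) m p q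
    (F : 'cV[R]_m -> 'M[R]_(p, q)) r :
  ominimal_structure Def -> def_mx Def F -> @Def m [set z | \rank (F z) = r].
Proof.
move=> omin dF; rewrite (_ : mkset _ = [set z |
    exists (C : 'M[R]_(p, r)) (B : 'M[R]_(r, q))
      (C' : 'M[R]_(r, p)) (B' : 'M[R]_(q, r)), F z = C *m B /\ C' *m F z *m B' = 1%:M]).
  do 4 apply: def_exists_mx => //.
  (* After the four quantifiers [F] is evaluated at a projection of the enlarged vector; this form
     lets [def_mx_tac] handle it. *)
  have dFc l (g : 'cV[R]_l -> 'cV[R]_m) : def_mx Def g -> def_mx Def (fun z => F (g z)).
    exact: def_mx_comp.
  by apply: (def_and omin); apply: def_eqmx; def_mx_tac.
by apply/seteqP; split => z /mxrankP.
Qed.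

(** * Boundaries of definable sets *)

Section BoundaryNull.
Context {R : realType} (Def : forall m, set (set 'cV[R]_m)).
Hypothesis omin : ominimal_structure Def.

(** The list collects the finite end points of the intervals composing [U]. Any other point of [U]
    is interior to the interval that contains it. *)
Lemma def_set_interior (U : set R) : @Def 1%N [set z : 'cV[R]_1 | U (z 0 0)] ->
  exists s : seq R, forall t, U t -> t \notin s -> nbhs t U.
Proof.
move=> /(om_dim1 omin)[s Us].
have UE t : U t <-> exists2 I, I \in s & t \in I.
  have : [set z : 'cV[R]_1 | U (z 0 0)] (const_mx t) <->
      [set z : 'cV[R]_1 | exists2 I, I \in s & z 0 0 \in I] (const_mx t).
    by rewrite Us.
  by rewrite /= mxE.
pose e (b : itv_bound R) := if b is BSide _ x then [:: x] else [::].
exists (flatten [seq e (let: Interval l _ := J in l) ++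
                     e (let: Interval _ r := J in r) | J : interval R <- s]).
move=> t /UE[[l r] Is tI] ts.
have {}ts x : x \in e l ++ e r -> t != x.
  move=> xe; apply: contraNneq ts => ->; apply/flatten_mapP.
  by exists (Interval l r).
have tl : nbhs t [set x | (l <= BLeft x)%O].
  move: tI ts; rewrite itv_boundlr => /andP[].
  case: l {Is} => [b x|b].
    case: b; rewrite ?bnd_simp => xt _ /(_ x) h;
      (have {xt} xt : x < t by rewrite lt_neqAle ?xt ?ltW// eq_sym h// inE eqxx);
      apply: filterS (lt_nbhsr xt) => y xy; rewrite /= bnd_simp ?ltW//.
  by case: b => //= _ _ _; apply: (filterS _ filterT).
have tr : nbhs t [set x | (BRight x <= r)%O].
  move: tI ts; rewrite itv_boundlr => /andP[_].
  case: r {Is} => [b x|b].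
    case: b; rewrite ?bnd_simp => xt /(_ x) h;
      (have {xt} xt : t < x
        by rewrite lt_neqAle ?xt ?ltW// h// mem_cat inE eqxx orbT);
      apply: filterS (lt_nbhsl xt) => y xy; rewrite /= bnd_simp ?ltW//.
  by case: b => //= _ _; apply: (filterS _ filterT).
apply: filterS2 tl tr => y ly yr; apply/UE; exists (Interval l r) => //.
by rewrite itv_boundlr ly.
Qed.

Lemma def_box m (u v : 'cV[R]_m) : @Def m (box u v).
Proof.
apply: def_forall_fin => // i.
rewrite (_ : mkset _ = [set x : 'cV[R]_m | u i 0 <= x i 0 /\ x i 0 <= v i 0]).
  apply: (def_and omin); apply: def_le => //;
    by [exact: def_fun_cst|exact: def_fun_coord].
by apply/seteqP; split => x /= /andP.
Qed.

(** Rational vertices leave only countably many boxes, which keeps the set of exceptional levels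
    countable. *)
Lemma rational_box_nbhs m (x : 'cV[R]_m) (A : set 'cV[R]_m) : nbhs x A ->
  exists p q : 'cV[rat]_m,
    box (map_mx ratr p) (map_mx ratr q) `<=` A /\
    nbhs x (box (map_mx ratr p : 'cV[R]_m) (map_mx ratr q)).
Proof.
move=> /cV_nbhsP[r r0 rA].
have /choice[p pP] : forall i, exists p : rat, x i 0 - r < ratr p < x i 0.
  by move=> i; have [|p] := @rat_in_itvoo R (x i 0 - r) (x i 0);
    [lra|rewrite in_itv/=; exists p].
have /choice[q qP] : forall i, exists q : rat, x i 0 < ratr q < x i 0 + r.
  by move=> i; have [|q] := @rat_in_itvoo R (x i 0) (x i 0 + r);
    [lra|rewrite in_itv/=; exists q].
exists (\col_i p i), (\col_i q i); split.
  move=> y ypq; apply: rA => i; have := ypq i; rewrite !mxE.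
  by have := pP i; have := qP i; rewrite ltr_norml; lra.
have := @open_box_open R m (map_mx ratr (\col_i p i)) (map_mx ratr (\col_i q i)).
rewrite openE => /(_ x) => h.
have {}h : nbhs x [set y : 'cV[R]_m | forall i,
    map_mx ratr (\col_i p i) i 0 < y i 0 < map_mx ratr (\col_i q i) i 0].
  apply: h => i; rewrite !mxE.
  by have /andP[_ ->] := pP i; have /andP[-> _] := qP i.
by apply: filterS h => y ypq i; have /andP[/ltW-> /ltW->] := ypq i.
Qed.

Lemma def_slice m (A : set 'cV[R]_(1 + m)) (t : R) :
  @Def (1 + m)%N A -> @Def m (slice A t).
Proof.
move=> dA; apply: (def_preimage omin dA).
by apply: def_mx_col; [apply: def_cstmx|apply: def_mx_id].
Qed.

(* N consists of the end points of the intervals that form, for all rational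
   boxes Q, the definable subset {t | {t} x Q is contained in A} of the line. *)
Lemma slice_interior m (A : set 'cV[R]_(1 + m)) : @Def (1 + m)%N A ->
  exists N : set R, countable N /\
    forall t w, ~ N t -> (slice A t)^° w -> A^° (col_mx (const_mx t) w).
Proof.
move=> dA.
pose b (p : 'cV[rat]_m) : 'cV[R]_m := map_mx ratr p.
pose U p q : set R := [set t | forall w, box (b p) (b q) w -> slice A t w].
have dU p q : @Def 1%N [set z : 'cV[R]_1 | U p q (z 0 0)].
  apply: (def_forall_cV omin (P := fun z w => box (b p) (b q) w -> slice A (z 0 0) w)).
  apply: (def_imply omin).
    apply: (def_preimage omin (def_box _ _)).
    by apply: def_mx_dsubmx; exact: def_mx_id.
  rewrite (_ : mkset _ = A)//; apply/seteqP.
  have e (z : 'cV[R]_(1 + m)) : col_mx (const_mx (usubmx z 0 0)) (dsubmx z) = z.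
    rewrite -[RHS]vsubmxK; congr col_mx.
    by apply/colP => i; rewrite !mxE ord1.
  by split => z; rewrite /slice /= e.
have /choice[s sP] : forall pq : 'cV[rat]_m * 'cV[rat]_m, exists s : seq R,
    forall t, U pq.1 pq.2 t -> t \notin s -> nbhs t (U pq.1 pq.2).
  by move=> pq; exact: def_set_interior.
exists (\bigcup_pq [set` s pq]); split.
  apply: bigcup_countable => // pq _.
  by apply: finite_set_countable; exact: finite_seq.
move=> t w Nt /rational_box_nbhs[p [q [pqA wpq]]].
(* The level [t] is in [U p q] and is not one of its end points, so nearby levels are in [U p q]
   too. The product of these levels with the box is then a neighbourhood contained in [A]. *)
have /(sP (p, q))/= : U p q t by move=> w' /pqA.
have /negP tpq : ~ (t \in s (p, q)) by move=> tpq; apply: Nt; exists (p, q).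
move=> /(_ tpq) /nbhs_ballP[r /= r0 rU].
move: wpq => /cV_nbhsP[r' r'0 rpq].
apply/cV_nbhsP; exists (Num.min r r'); first by rewrite lt_min r0.
move=> z zP.
have zt : U p q (z 0 0).
  apply: rU; rewrite /ball/=; have := zP 0.
  rewrite {1}(_ : 0 = lshift m (0 : 'I_1)); last exact: val_inj.
  by rewrite col_mxEu mxE lt_min => /andP[].
have := zt (dsubmx z); rewrite /slice /=.
rewrite (_ : col_mx _ _ = z); last first.
  rewrite -[RHS]vsubmxK; congr col_mx.
  by apply/colP => i; rewrite !mxE ord1; congr (z _ _); exact: val_inj.
apply; apply: rpq => i.
by have := zP (rshift 1 i); rewrite col_mxEd lt_min mxE => /andP[].
Qed.

Lemma boundary_closed (T : topologicalType) (A : set T) : closed (boundary A).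
Proof.
apply: closedI; first exact: closed_closure.
by apply: open_closedC; exact: open_interior.
Qed.

Lemma boundaryE (T : topologicalType) (A : set T) :
  boundary A = ~` (A^° `|` (~` A)^°).
Proof. by rewrite /boundary interiorC setCU setCK setDE setIC. Qed.

Lemma boundary_lebesgue_null m (A : set 'cV[R]_m) :
  @Def m A -> lebesgue_null (boundary A).
Proof.
elim: m A => [|m IH] A dA.
  (* In dimension 0 the space is a single point, so every set is open and the boundary is empty; a
     nonempty set would not be null, since boxes have volume 1. *)
  apply: lebesgue_nullW (lebesgue_null_set0 0); rewrite boundaryE => x [].
  have [Ax|nAx] := pselect (A x); [left|right]; apply/cV_nbhsP; exists 1 => // y _;
    by rewrite (flatmx0 y) -(flatmx0 x).
have [N1 [cN1 N1P]] := @slice_interior m A dA.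
have [N2 [cN2 N2P]] := @slice_interior m (~` A) (om_setC omin dA).
apply: (@lebesgue_null_slices R m (boundary A) (N1 `|` N2)).
- exact: boundary_closed.
- rewrite -bigcup2E; apply: bigcup_countable => // -[|[|i]] _ //=.
- move=> t /not_orP[nN1 nN2].
  apply: lebesgue_nullW (IH _ (@def_slice m A t dA)) => w.
  rewrite /slice /= !boundaryE /= => + [Aw|Aw]; apply.
    by left; exact: N1P.
  by right; exact: N2P.
Qed.

End BoundaryNull.

(** * Total variation of discrete measures *)

Section Atoms.
Context (R : realType) (X : Type) (k : nat) (a : 'cV[R]_k) (x : 'I_k -> X).

(* The points x j may coincide: atom_mass j is the total weight of the point x j
   and atom_mult j the number of indices of this point.  The weights
   atom_mass / atom_mult define the same measure as the weights a and, unlike a,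
   have one sign at each point. *)
Definition atom_mass j : R := \sum_i if `[< x i = x j >] then a i 0 else 0.
Definition atom_mult j : R := \sum_i if `[< x i = x j >] then 1 else 0.

Lemma atom_mult_gt0 j : 0 < atom_mult j.
Proof.
rewrite /atom_mult (bigD1 j)//= asboolT// ltr_pwDl//.
by apply: sumr_ge0 => i _; case: ifP.
Qed.

(** After exchanging the sums, each weight [a i] is distributed in equal shares among the
    [atom_mult] indices of the point [x i]. *)
Lemma sum_atoms (g : X -> R) :
  \sum_j atom_mass j / atom_mult j * g (x j) = \sum_j a j 0 * g (x j).
Proof.
under eq_bigr => j _ do rewrite /atom_mass mulr_suml mulr_suml.
rewrite exchange_big /=; apply: eq_bigr => i _.
rewrite -[RHS]mul1r -(divff (lt0r_neq0 (atom_mult_gt0 i))) {1}/atom_mult.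
rewrite -mulrA mulr_suml; apply: eq_bigr => j _.
case: (asboolP (x i = x j)) => [ij|ij]; last first.
  by rewrite asboolF ?mul0r// => ji; apply: ij.
rewrite asboolT// mul1r /atom_mult ij mulrCA mulrA.
by rewrite mulrAC.
Qed.

End Atoms.

Section DiscreteCharges.
Context (disp : measure_display) (T : measurableType disp) (R : realType).

Lemma ge0_integral_sum_dirac (D : set T) k (w : 'I_k -> R) (x : 'I_k -> T)
    (m : {measure set T -> \bar R}) (f : T -> \bar R) :
  measurable D -> (forall j, D (x j)) -> (forall j, 0 <= w j) ->
  (forall A, measurable A -> A `<=` D ->
    m A = \sum_(j < k) (w j)%:E * \d_(x j) A)%E ->
  measurable_fun D f -> (forall t, D t -> 0 <= f t)%E ->
  (\int[m]_(t in D) f t = \sum_(j < k) (w j)%:E * f (x j))%E.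
Proof.
move=> mD Dx w0 mE mf f0.
(* [msum] takes sequences indexed by [nat]; the values chosen beyond [k] do not enter the sum. *)
pose wn i := if insub i is Some j then w j else 0.
have wn0 i : 0 <= wn i by rewrite /wn; case: insubP.
pose xn i : T := if insub i is Some j then x j else point.
have wnE (j : 'I_k) : wn j = w j.
  by rewrite /wn; case: insubP => [j' _ /val_inj ->|]; rewrite ?ltn_ord.
have xnE (j : 'I_k) : xn j = x j.
  by rewrite /xn; case: insubP => [j' _ /val_inj ->|]; rewrite ?ltn_ord.
rewrite (@eq_measure_integral _ _ _ D
  (msum (fun i => mscale (NngNum (wn0 i)) (\d_(xn i))) k)); last first.
  move=> A mA AD; rewrite mE//; apply: eq_bigr => j _.
  by rewrite /mscale /= -wnE -xnE.
rewrite ge0_integral_measure_sum//; apply: eq_bigr => j _.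
rewrite ge0_integral_mscale// integral_dirac//= -wnE -xnE.
by rewrite diracE mem_set ?mul1e// xnE.
Qed.

Lemma integral_sum_dirac (D : set T) k (w : 'I_k -> R) (x : 'I_k -> T)
    (m : {measure set T -> \bar R}) (f : T -> R) :
  measurable D -> (forall j, D (x j)) -> (forall j, 0 <= w j) ->
  (forall A, measurable A -> A `<=` D ->
    m A = \sum_(j < k) (w j)%:E * \d_(x j) A)%E ->
  measurable_fun D f ->
  (\int[m]_(t in D) (f t)%:E = (\sum_(j < k) w j * f (x j))%R%:E)%E.
Proof.
move=> mD Dx w0 mE mf.
have mF : measurable_fun D (EFin \o f) by exact/measurable_EFinP.
rewrite integralE.
rewrite (ge0_integral_sum_dirac mD Dx w0 mE) //; last exact: measurable_funepos.
rewrite (ge0_integral_sum_dirac mD Dx w0 mE) //; last exact: measurable_funeneg.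
under eq_bigr do rewrite funerpos -EFinM.
under [X in (_ - X)%E]eq_bigr do rewrite funerneg -EFinM.
rewrite !sumEFin -EFinB -sumrB; congr EFin; apply: eq_bigr => j _.
by rewrite -mulrBr -[in RHS](funrposBneg f).
Qed.

Lemma sum_diracE k (w : 'I_k -> R) (x : 'I_k -> T) (A : set T) :
  (\sum_(j < k) (w j)%:E * \d_(x j) A =
   (\sum_(j < k) w j * (x j \in A)%:R)%R%:E)%E.
Proof. by rewrite -sumEFin; apply: eq_bigr => j _; rewrite diracE EFinM. Qed.

Section Weights.
Variables (k : nat) (a : 'cV[R]_k) (x : 'I_k -> T).
Local Notation atom_mass := (atom_mass a x).
Local Notation atom_mult := (atom_mult R x).

Lemma discrete_measureE (A : set T) : discrete_measure a x A =
  (\sum_(j < k) (atom_mass j / atom_mult j)%:E * \d_(x j) A)%E.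
Proof.
rewrite /discrete_measure sum_diracE [RHS]sum_diracE.
by rewrite -(sum_atoms a x (fun t => (t \in A)%:R)).
Qed.

Lemma discrete_measure_atom j :
  discrete_measure a x [set x j] = (atom_mass j)%:E.
Proof.
rewrite /discrete_measure /atom_mass -sumEFin; apply: eq_bigr => i _.
rewrite diracE; case: asboolP => [->|ij].
  by rewrite mem_set// mule1.
by rewrite memNset// mule0.
Qed.

Variable D : set T.
Hypotheses (mD : measurable D) (Dx : forall j, D (x j)).
Hypothesis mx : forall j, measurable [set x j].
Let nu : {charge set T -> \bar R} := discrete_measure a x.
Let P := (hahn_pair nu).1.
Let N := (hahn_pair nu).2.

Let xPN j : P (x j) \/ N (x j).
Proof.
have [_ _ PN _] := hahn_pairP nu.
have : [set: T] (x j) by []. by rewrite -PN.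
Qed.

(** The singleton of [x j] is a measurable subset of the positive set [P], and its charge is
    [atom_mass j]. *)
Let atomP j : P (x j) -> 0 <= atom_mass j / atom_mult j.
Proof.
move=> Px; apply: divr_ge0; last exact/ltW/(atom_mult_gt0 R).
rewrite -lee_fin -discrete_measure_atom.
have [[_ posP] _ _ _] := hahn_pairP nu.
by apply: posP => // _ ->.
Qed.

Let atomN j : N (x j) -> atom_mass j / atom_mult j <= 0.
Proof.
move=> Nx; rewrite pmulr_lle0 ?invr_gt0 ?(atom_mult_gt0 R)//.
rewrite -lee_fin -discrete_measure_atom.
have [_ [_ negN] _ _] := hahn_pairP nu.
by apply: negN => // _ ->.
Qed.

(** Weights of the two Jordan parts. They are read off from the chosen Hahn pair, so atoms of mass 0
    may fall on either side. *)
Let wpos j : R := if `[< P (x j) >] then atom_mass j / atom_mult j else 0.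
Let wneg j : R := if `[< N (x j) >] then - (atom_mass j / atom_mult j) else 0.

Let wpos_ge0 j : 0 <= wpos j.
Proof. by rewrite /wpos; case: asboolP => // /atomP. Qed.

Let wneg_ge0 j : 0 <= wneg j.
Proof. by rewrite /wneg; case: asboolP => // /atomN; rewrite oppr_ge0. Qed.

Let wposneg j : wpos j - wneg j = atom_mass j / atom_mult j.
Proof.
rewrite /wpos /wneg; have [_ _ _ PN0] := hahn_pairP nu.
case: asboolP => [Px|nPx]; case: asboolP => [Nx|nNx].
- by have : set0 (x j) by rewrite -PN0.
- by rewrite subr0.
- by rewrite sub0r opprK.
- by have [] := xPN j.
Qed.

Let wabs j : wpos j + wneg j = `|atom_mass j| / atom_mult j.
Proof.
have m0 := atom_mult_gt0 R x j.
have -> : `|atom_mass j| / atom_mult j = `|atom_mass j / atom_mult j|.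
  by rewrite normrM normfV (gtr0_norm m0).
rewrite -wposneg /wpos /wneg; have [_ _ _ PN0] := hahn_pairP nu.
case: asboolP => [Px|nPx]; case: asboolP => [Nx|nNx].
- by have : set0 (x j) by rewrite -PN0.
- by rewrite subr0 addr0 ger0_norm// atomP.
- by rewrite sub0r opprK add0r ler0_norm// atomN.
- by have [] := xPN j.
Qed.

(** The positive part is the restriction of [nu] to [P], which retains exactly the atoms lying in
    [P]. *)
Let jordan_posE' A : measurable A ->
  (jordan_pos (hahn_pairP nu) A = \sum_(j < k) (wpos j)%:E * \d_(x j) A)%E.
Proof.
move=> mA; rewrite jordan_posE cjordan_posE /crestr0 mem_set//= /crestr.
rewrite discrete_measureE; apply: eq_bigr => j _.
rewrite /wpos !diracE; case: asboolP => [Px|nPx].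
  by rewrite in_setI (mem_set Px) andbT.
by rewrite in_setI (memNset nPx) andbF mule0 mul0e.
Qed.

Let jordan_negE' A : measurable A ->
  (jordan_neg (hahn_pairP nu) A = \sum_(j < k) (wneg j)%:E * \d_(x j) A)%E.
Proof.
move=> mA; rewrite jordan_negE cjordan_negE /crestr0 mem_set//= /crestr.
rewrite discrete_measureE !sum_diracE -EFinN -sumrN; congr EFin; apply: eq_bigr => j _.
rewrite /wneg; case: asboolP => [Nx|nNx].
  by rewrite in_setI (mem_set Nx) andbT mulNr.
by rewrite in_setI (memNset nNx) andbF mulr0 mul0r oppr0.
Qed.

Lemma charge_integral_discrete (f : T -> R) : measurable_fun D f ->
  charge_integral nu D f = (\sum_j a j 0 * f (x j))%:E.
Proof.
move=> mf; rewrite /charge_integral.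
rewrite (integral_sum_dirac mD Dx wpos_ge0 (fun A mA _ => jordan_posE' mA) mf).
rewrite (integral_sum_dirac mD Dx wneg_ge0 (fun A mA _ => jordan_negE' mA) mf).
rewrite -EFinB -sumrB -(sum_atoms a x); congr EFin; apply: eq_bigr => j _.
by rewrite -mulrBl wposneg.
Qed.

(** Division by the multiplicity makes each distinct point count once, with the absolute value of
    its total weight. *)
Lemma total_variation_discrete :
  Defs.total_variation nu D = (\sum_j `|atom_mass j| / atom_mult j)%:E.
Proof.
rewrite /Defs.total_variation /charge_variation jordan_posE' // jordan_negE' //.
have dD j : (\d_(x j) D = 1 :> \bar R)%E by rewrite diracE mem_set.
under eq_bigr do rewrite dD mule1.
under [X in (_ + X)%E]eq_bigr do rewrite dD mule1.
by rewrite !sumEFin -EFinD -big_split; under eq_bigr do rewrite /= wabs.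
Qed.

End Weights.
End DiscreteCharges.

(** * The subdifferential condition without quantification over functions *)

Section Subdifferential.
Context {R : realType} (n d : nat) (lambda : R).
Variables (Omega : set 'cV[R]_d) (phi : 'cV[R]_d -> 'cV[R]_n).
Hypotheses (lambda_gt0 : 0 < lambda) (cphi : {within Omega, continuous phi}).
Local Notation T := (borel_on Omega).

Lemma measurable_open_subspace (A : set 'cV[R]_d) :
  @open (subspace Omega) A -> measurable (A : set T).
Proof. by move=> oA; apply: sub_sigma_algebra. Qed.

Lemma measurable_borel_on : measurable (Omega : set T).
Proof. by apply: measurable_open_subspace; exact: open_subspaceT. Qed.

(** Singletons are closed in the Euclidean topology, hence in the finer topology of
    [subspace Omega]. *)
Lemma measurable_borel_on1 (x : 'cV[R]_d) : measurable ([set x] : set T).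
Proof.
rewrite -[X in measurable X]setCK; apply: measurableC.
apply: measurable_open_subspace; apply: closed_openC.
apply: closed_subspaceW; apply: accessible_closed_set1.
exact/hausdorff_accessible/norm_hausdorff.
Qed.

Lemma continuous_measurable_borel_on (f : 'cV[R]_d -> R) :
  {within Omega, continuous f} -> measurable_fun (Omega : set T) (f : T -> R).
Proof.
move=> /continuousP cf mO; apply: (measurability _ (RGenOpens.measurableE R)) => //.
move=> _ [_ [a [b ->] <-]]; apply: measurableI => //.
by apply: measurable_open_subspace; apply: cf; exact: interval_open.
Qed.

Lemma continuous_Phi_adj (p : 'cV[R]_n) : {within Omega, continuous (Phi_adj phi p)}.
Proof.
pose g (w : 'cV[R]_n) := \sum_(i < n) w i 0 * p i 0.
have cg : continuous g.
  apply: continuous_big => [|i _ w]; first exact: add_continuous.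
  exact: (cvgM (@continuous_coord R n i w) (cvg_cst (p i 0))).
move=> z; apply: (@continuous_comp (subspace Omega) _ _ phi g).
  exact: cphi.
exact: cg.
Qed.

(** On [Omega] the function [f] is forced to be [Phi_adj phi p] divided by [lambda]. This candidate
    is continuous because [phi] is, so the quantifier over functions can be eliminated. *)
Lemma subdiff_tvP k (a : 'cV[R]_k) (x : 'I_k -> 'cV[R]_d) (p : 'cV[R]_n) :
  (forall j, Omega (x j)) ->
  (exists2 f, subdiff_tv (discrete_measure a (x : 'I_k -> T)
      : {charge set T -> \bar R}) f &
    forall z, Omega z -> Phi_adj phi p z = lambda * f z) <->
  (forall z, Omega z -> `|Phi_adj phi p z| <= lambda) /\
  \sum_j a j 0 * Phi_adj phi p (x j) =
    lambda * \sum_j `|atom_mass a x j| / atom_mult R x j.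
Proof.
move=> Ox.
have Ex f : {within Omega, continuous f} ->
    charge_integral (discrete_measure a (x : 'I_k -> T)
      : {charge set T -> \bar R}) Omega f =
    Defs.total_variation (discrete_measure a (x : 'I_k -> T)
      : {charge set T -> \bar R}) Omega <->
    \sum_j a j 0 * f (x j) = \sum_j `|atom_mass a x j| / atom_mult R x j.
  move=> /continuous_measurable_borel_on mf.
  rewrite charge_integral_discrete//; first last.
  - by move=> j; exact: measurable_borel_on1.
  - exact: measurable_borel_on.
  rewrite total_variation_discrete//; first last.
  - by move=> j; exact: measurable_borel_on1.
  - exact: measurable_borel_on.
  by split=> [[]|->].
split=> [[f [cf f1 /(Ex _ cf) If] pf]|[p1 Ip]].
  split=> [z Oz|].
    rewrite pf// normrM (gtr0_norm lambda_gt0) -[leRHS]mulr1 ler_pM2l//.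
    rewrite -lee_fin; apply: le_trans f1; apply: ereal_sup_ubound.
    by exists z.
  rewrite -If mulr_sumr; apply: eq_bigr => j _.
  by rewrite pf// mulrCA.
have l0 : lambda != 0 by rewrite gt_eqF.
pose q : 'cV[R]_n := lambda^-1 *: p.
have qE z : Phi_adj phi q z = lambda^-1 * Phi_adj phi p z.
  by rewrite /Phi_adj mulr_sumr; apply: eq_bigr => i _; rewrite mxE mulrCA.
exists (Phi_adj phi q); last by move=> z _; rewrite qE mulrA divff// mul1r.
have cq : {within Omega, continuous (Phi_adj phi q)} by exact: continuous_Phi_adj.
split=> //.
  apply: ge_ereal_sup => _ [z Oz <-]; rewrite lee_fin qE normrM normfV.
  by rewrite (gtr0_norm lambda_gt0) ler_pdivrMl// mulr1 p1.
apply/(Ex _ cq); apply: (mulfI l0); rewrite -Ip mulr_sumr.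
by apply: eq_bigr => j _; rewrite qE mulrCA (mulrA lambda) divff// mul1r.
Qed.

End Subdifferential.

(** * Definability of the projections *)

Section DefinabilityOfQ.
Context {R : realType} (Def : forall m, set (set 'cV[R]_m)).
Hypothesis omin : ominimal_structure Def.
Local Notation def_fun := (def_fun Def).
Local Notation def_mx := (def_mx Def).
Arguments Def {m}.

(** The convention that the inverse of 0 is 0 accounts for the first disjunct of the formula. *)
Lemma def_inv m (s : 'cV[R]_m -> R) : def_fun s -> def_fun (fun x => (s x)^-1).
Proof.
move=> ds; have dsu := def_fun_usubmx omin 1 ds; have dl := @def_fun_last _ _ omin m.
apply: (@def_fun_graphE _ _ omin _ _ (fun z =>
   (s (usubmx z) = 0 /\ z (rshift m 0) 0 = 0) \/
   (s (usubmx z) <> 0 /\ z (rshift m 0) 0 * s (usubmx z) = 1))).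
  have d0 c := def_fun_cst omin (m + 1) c.
  apply: (def_or omin); apply: (def_and omin).
  - exact: def_eq.
  - exact: def_eq.
  - by apply: (def_not omin); exact: def_eq.
  - by apply: def_eq => //; exact: def_mul.
move=> z; have [->|/eqP s0] := eqVneq (s (usubmx z)) 0.
  by rewrite invr0; split=> [[[_ ->]|[]]//|->]; left.
split=> [[[]//|[_ zs]]|->].
  by apply: (mulIf (introN eqP s0)); rewrite zs mulVf//; apply/eqP.
by right; split => //; rewrite mulVf//; apply/eqP.
Qed.

Lemma def_norm m (s : 'cV[R]_m -> R) : def_fun s -> def_fun (fun x => `|s x|).
Proof.
move=> ds; rewrite (_ : (fun _ => _) = fun x => if `[< 0 <= s x >] then s x else - s x).
  apply: def_if => //; last exact: def_opp.
  by apply: def_le => //; exact: def_fun_cst.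
apply/funext => x; case: asboolP => [s0|/negP]; first by rewrite ger0_norm.
by rewrite -ltNge => /ltW s0; rewrite ler0_norm.
Qed.

Lemma def_col m p q (F : 'cV[R]_m -> 'M[R]_(p, q)) j :
  def_mx F -> def_mx (fun z => col j (F z)).
Proof.
move=> dF i l; rewrite (_ : (fun _ => _) = (fun z => F z i j))//.
by apply/funext => z; rewrite mxE.
Qed.

Section Context.
Variables (n d : nat) (phi : 'cV[R]_d -> 'cV[R]_n).
Hypothesis dphi : def_mx phi.

Lemma def_Phi_mx m k (X : 'cV[R]_m -> 'M[R]_(d, k)) :
  def_mx X -> def_mx (fun z => Phi_mx phi (fun j => col j (X z))).
Proof.
move=> dX i j; rewrite (_ : (fun _ => _) = (fun z => phi (col j (X z)) i 0)).
  by apply: (def_fun_comp omin (dphi i 0)); exact: def_col.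
by apply/funext => z; rewrite mxE.
Qed.

Lemma def_Phi_adj m (P : 'cV[R]_m -> 'cV[R]_n) (Z : 'cV[R]_m -> 'cV[R]_d) :
  def_mx P -> def_mx Z -> def_fun (fun z => Phi_adj phi (P z) (Z z)).
Proof.
move=> dP dZ; apply: def_sum => // i; apply: def_mul => //.
exact: (def_fun_comp omin (dphi i 0)).
Qed.

Lemma def_atom_mass m k (A : 'cV[R]_m -> 'cV[R]_k) (X : 'cV[R]_m -> 'M[R]_(d, k)) j :
  def_mx A -> def_mx X ->
  def_fun (fun z => atom_mass (A z) (fun j => col j (X z)) j).
Proof.
move=> dA dX; apply: def_sum => // i; apply: def_if => //.
  by apply: def_eqmx => //; exact: def_col.
exact: def_fun_cst.
Qed.

Lemma def_atom_mult m k (X : 'cV[R]_m -> 'M[R]_(d, k)) j :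
  def_mx X -> def_fun (fun z => atom_mult R (fun j => col j (X z)) j).
Proof.
move=> dX; apply: def_sum => // i; apply: def_if => //; try exact: def_fun_cst.
by apply: def_eqmx => //; exact: def_col.
Qed.

Variables (Omega : set 'cV[R]_d) (lambda : R).
Hypothesis dOmega : Def Omega.
Variables (k : nat) (S : {set 'I_k}) (sigma : 'cV[R]_k) (I : {set 'I_k}).

(** First-order form of [setQ]: the points become the columns of [X], and the subdifferential
    condition is replaced by its equivalent from [subdiff_tvP]. *)
Definition formulaQ (y : 'cV[R]_n) (a : 'cV[R]_k) (X : 'M[R]_(d, k)) :=
  let M := Phi_mx phi (fun j => col j X) in
  [/\ forall j, Omega (col j X),
    (forall z, Omega z -> `|Phi_adj phi (y - M *m a) z| <= lambda) /\
     \sum_j a j 0 * Phi_adj phi (y - M *m a) (col j X) =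
       lambda * \sum_j `|atom_mass a (fun j => col j X) j|
         / atom_mult R (fun j => col j X) j,
    \rank M = #|S| &
    forall j : 'I_#|S|, enum_val j \in I ->
      ((rows S (Defs.pinv M) + Defs.pinv (cols S M) *m cols (~: S) M
                              *m rows (~: S) (Defs.pinv M))
        *m (y - Defs.pinv M^T *m (lambda *: sigma))) j 0 = 0].

Lemma def_formulaQ : Def [set y | exists a X, formulaQ y a X].
Proof.
apply: def_exists_mx => //; apply: def_exists_mx => //.
set c := (n + k * 1 + d * k)%N.
pose y (z : 'cV[R]_c) := usubmx (usubmx z).
pose a (z : 'cV[R]_c) := vec_mx (dsubmx (usubmx z))^T.
pose X (z : 'cV[R]_c) : 'M[R]_(d, k) := vec_mx (dsubmx z)^T.
pose M (z : 'cV[R]_c) := Phi_mx phi (fun j => col j (X z)).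
have dy : def_mx y by do 2 apply: def_mx_usubmx; exact: def_mx_id.
have da : def_mx a.
  apply: def_vec_mx; apply: def_trmx; apply: def_mx_dsubmx.
  by apply: def_mx_usubmx; exact: def_mx_id.
have dX : def_mx X.
  by apply: def_vec_mx; apply: def_trmx; apply: def_mx_dsubmx; exact: def_mx_id.
have dM : def_mx M by exact: def_Phi_mx.
pose r z := y z - M z *m a z.
have dr : def_mx r by apply: def_addmx => //; apply: def_oppmx => //; exact: def_mulmx.
rewrite (_ : mkset _ = [set z |
  ((forall j, Omega (col j (X z))) /\ \rank (M z) = #|S|) /\
  (((forall w, Omega w -> `|Phi_adj phi (r z) w| <= lambda) /\
   \sum_j a z j 0 * Phi_adj phi (r z) (col j (X z)) =
       lambda * \sum_j `|atom_mass (a z) (fun j => col j (X z)) j|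
         / atom_mult R (fun j => col j (X z)) j) /\
   forall j : 'I_#|S|, enum_val j \in I ->
      ((rows S (Defs.pinv (M z)) + Defs.pinv (cols S (M z)) *m cols (~: S) (M z)
                              *m rows (~: S) (Defs.pinv (M z)))
        *m (y z - Defs.pinv (M z)^T *m (lambda *: sigma))) j 0 = 0)]); last first.
  apply/seteqP; split => z /=; first by case.
  by move=> [[? ?] [? ?]].
apply: (def_and omin).
  apply: (def_and omin); last exact: def_rank.
  apply: def_forall_fin => // j; apply: (def_preimage omin dOmega).
  exact: def_col.
apply: (def_and omin).
  apply: (def_and omin).
    apply: (def_forall_cV omin
      (P := fun z w => Omega w -> `|Phi_adj phi (r z) w| <= lambda)).
    apply: (def_imply omin).
      apply: (def_preimage omin dOmega); apply: def_mx_dsubmx; exact: def_mx_id.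
    apply: def_le => //; last exact: def_fun_cst.
    apply: def_norm; apply: def_Phi_adj.
      by apply: (def_mx_comp omin dr); apply: def_mx_usubmx; exact: def_mx_id.
    by apply: def_mx_dsubmx; exact: def_mx_id.
  apply: def_eq => //.
    apply: def_sum => // j; apply: def_mul => //.
    by apply: def_Phi_adj => //; exact: def_col.
  apply: def_mul => //; first exact: def_fun_cst.
  apply: def_sum => // j; apply: def_mul => //.
    by apply: def_norm; exact: def_atom_mass.
  by apply: def_inv; exact: def_atom_mult.
apply: def_forall_fin => // j.
(* Membership in [I] does not depend on [z]: it decides whether the condition is an equation or is
   void. *)
have [jI|jI] := boolP (enum_val j \in I); last first.
  rewrite (_ : mkset _ = setT); first exact: def_setT.
  by apply/seteqP; split.
have dF : def_mx (fun z =>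
    (rows S (Defs.pinv (M z)) + Defs.pinv (cols S (M z)) *m cols (~: S) (M z)
      *m rows (~: S) (Defs.pinv (M z)))
    *m (y z - Defs.pinv (M z)^T *m (lambda *: sigma))).
  by rewrite /rows /cols; def_mx_tac.
have := def_eq omin (dF j 0) (def_fun_cst omin _ 0); congr Def.
by apply/seteqP; split => z /= => [e _|/(_ isT)]; first exact: e.
Qed.

End Context.

(* The values of phi outside Omega are arbitrary, so phi itself need not be
   definable. *)
Definition zero_outside (n d : nat) (Omega : set 'cV[R]_d)
    (phi : 'cV[R]_d -> 'cV[R]_n) z := if `[< Omega z >] then phi z else 0.

Lemma def_zero_outside n d (Omega : set 'cV[R]_d) (phi : 'cV[R]_d -> 'cV[R]_n) :
  Def Omega -> Def (fun_graph Omega phi) -> def_mx (zero_outside Omega phi).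
Proof.
move=> dO dphi i j; rewrite ord1.
apply: (@def_fun_graphE _ _ omin _ _ (fun z =>
  (Omega (usubmx z) /\ exists w, fun_graph Omega phi (col_mx (usubmx z) w) /\
     z (rshift d 0) 0 = w i 0) \/
  (~ Omega (usubmx z) /\ z (rshift d 0) 0 = 0))).
  have dOu : Def [set z : 'cV[R]_(d + 1) | Omega (usubmx z)].
    by apply: (def_preimage omin dO); apply: def_mx_usubmx; exact: def_mx_id.
  apply: (def_or omin); apply: (def_and omin) => //; last first.
  - by apply: def_eq; [|exact: def_fun_last|exact: def_fun_cst].
  - exact: def_not.
  apply: (def_exists_cV omin (P := fun z w =>
    fun_graph Omega phi (col_mx (usubmx z) w) /\ z (rshift d 0) 0 = w i 0)).
  have du : def_mx (fun z : 'cV[R]_(d + 1 + n) => usubmx z).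
    by apply: def_mx_usubmx; exact: def_mx_id.
  have dd : def_mx (fun z : 'cV[R]_(d + 1 + n) => dsubmx z).
    by apply: def_mx_dsubmx; exact: def_mx_id.
  apply: (def_and omin); last by apply: def_eq => //.
  apply: (def_preimage omin dphi); apply: def_mx_col => //.
  exact: def_mx_usubmx.
move=> z; rewrite /zero_outside; case: asboolP => [Oz|nOz]; last first.
  by rewrite mxE; split=> [[[]|[]]//|->]; right.
split=> [[[_ [w [[x Ox /eq_col_mx[<- <-]] ->]]]|[]]//|->].
left; split => //; exists (phi (usubmx z)); split => //.
by exists (usubmx z).
Qed.

End DefinabilityOfQ.

(** Only values of [phi] on [Omega] enter [setQ], so [phi] may be replaced by
    [zero_outside Omega phi], which is definable on the whole space. *)
Lemma def_projection_setQ (R : realType) (n d : nat) (lambda : R)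
    (Omega : set 'cV[R]_d) (phi : 'cV[R]_d -> 'cV[R]_n)
    (Def : forall m : nat, set (set 'cV[R]_m))
    (k : nat) (S : {set 'I_k}) (sigma : 'cV[R]_k) (I : {set 'I_k}) :
  0 < lambda -> {within Omega, continuous phi} -> ominimal_structure Def ->
  @Def d Omega -> @Def (d + n)%N (fun_graph Omega phi) ->
  @Def n [set q.1.1 | q in setQ lambda Omega phi S sigma I].
Proof.
move=> lambda0 cphi omin dO dphi.
have := @def_formulaQ _ _ omin _ _ _ (def_zero_outside omin dO dphi)
  Omega lambda dO k S sigma I.
congr Def; have phiE z : Omega z -> zero_outside Omega phi z = phi z.
  by move=> Oz; rewrite /zero_outside asboolT.
have adjE p z : Omega z -> Phi_adj (zero_outside Omega phi) p z = Phi_adj phi p z.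
  by move=> Oz; apply: eq_bigr => i _; rewrite phiE.
have mxE' (x : 'I_k -> 'cV[R]_d) : (forall j, Omega (x j)) ->
    Phi_mx (zero_outside Omega phi) x = Phi_mx phi x.
  by move=> Ox; apply/matrixP => i j; rewrite !mxE phiE.
apply/seteqP; split=> /=.
  move=> y [a [X [OX [fle fI] rM eqI]]].
  rewrite mxE'// in fle fI rM eqI.
  exists ((y, a), fun j => col j X) => //; split => //.
  apply/(subdiff_tvP lambda0 cphi) => //; split=> [z Oz|].
    by rewrite -adjE//; exact: fle.
  by rewrite -fI; apply: eq_bigr => j _; rewrite adjE.
move=> _ [[[y a] x] [Ox fx rM eqI] <-] /=.
pose X := \matrix_(i < d, j < k) x j i 0.
have Xx : (fun j => col j X) = x.
  by apply/funext => j; apply/colP => i; rewrite !mxE.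
have Xxj j : col j X = x j by rewrite -Xx.
move: fx => /(subdiff_tvP lambda0 cphi)-/(_ Ox)[fle fI].
exists a, X; rewrite /formulaQ Xx mxE'//; split => //.
- by move=> j; rewrite Xxj.
- split=> [z Oz|]; first by rewrite adjE//; exact: fle.
  by rewrite -fI; apply: eq_bigr => j _; rewrite Xxj adjE.
Qed.

Theorem proposition3 (R : realType) (n d : nat) (lambda : R)
    (Omega : set 'cV[R]_d) (phi : 'cV[R]_d -> 'cV[R]_n)
    (Def : forall m : nat, set (set 'cV[R]_m)) :
  0 < lambda ->
  {within Omega, continuous phi} ->
  ominimal_structure Def ->
  Def d Omega ->
  Def (d + n)%N (fun_graph Omega phi) ->
  lebesgue_null (setH lambda Omega phi).
Proof.
move=> lambda0 cphi omin dO dphi.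
apply: lebesgue_null_bigcup => k _.
(* Coding sign vectors by boolean functions gives the union over [sigma] a finite index type, to
   which [lebesgue_null_bigcup_count] applies as it does for [S] and [I]. *)
pose sg (b : {ffun 'I_k -> bool}) : 'cV[R]_k := \col_j (if b j then 1 else -1).
apply: (@lebesgue_nullW _ _ _ (\bigcup_(b in [set: {ffun 'I_k -> bool}])
  \bigcup_(S in [set: {set 'I_k}]) \bigcup_(I in [set I : {set 'I_k} | I \subset S])
    boundary [set q.1.1 | q in setQ lambda Omega phi S (sg b) I])).
  move=> y [sigma ssigma Hy]; exists [ffun j => sigma j 0 == 1] => //.
  rewrite (_ : sg _ = sigma)//; apply/colP => j; rewrite !mxE ffunE.
  by case: (ssigma j) => ->; rewrite ?eqxx// eqNr oner_eq0.
do 3 (apply: lebesgue_null_bigcup_count => ? _).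
by apply: (boundary_lebesgue_null omin); exact: def_projection_setQ.
Qed.
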